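(* Let $b$ be a non-constant contractive multiplier of $H^2_d$. If $b$ is quasi-extreme, then there is a unique contractive solution $\mathbf X=(X_1,\dots,X_d)$ to the Gleason problem in $\mathcal H(b)$, and this solution is extremal.
   Context: Fix an integer $d\ge 1$; $\mathbb B^d$ is the open unit ball of $\mathbb C^d$, $\lambda^*$ denotes the complex conjugate of a scalar, and $zw^*=\sum_{j=1}^d z_jw_j^*$. $H^2_d$ (Drury–Arveson space) is the reproducing kernel Hilbert space on $\mathbb B^d$ with kernel $\frac1{1-zw^*}$. A contractive multiplier $b$ is a holomorphic function on $\mathbb B^d$ with $bf\in H^2_d$ and $\|bf\|\le\|f\|$ for all $f\in H^2_d$; $\mathcal H(b)$ is the reproducing kernel Hilbert space with kernel $k^b(z,w)=k^b_w(z)=\frac{1-b(z)b(w)^*}{1-zw^*}$. A $d$-tuple $\mathbf X=(X_1,\dots,X_d)$ of bounded operators on $\mathcal H(b)$ solves the Gleason problem in $\mathcal H(b)$ if $f(z)-f(0)=\sum_{j=1}^d z_j(X_jf)(z)$ for all $f\in\mathcal H(b)$, $z\in\mathbb B^d$. It is a contractive solution if moreover $\sum_{j}X_j^*X_j\le I-k^b_0\otimes k^b_0$, where $(u\otimes v)h=\langle h,v\rangle u$; a contractive solution is extremal if $\sum_jX_j^*X_j=I-k^b_0\otimes k^b_0$. $\mathbb F_d^+$ is the free semigroup of finite words in $1,\dots,d$ (including the empty word); on $\ell^2(\mathbb F_d^+)$ with orthonormal basis $\{\xi_w\}$ put $L_i\xi_w=\xi_{iw}$, so $L_i^*L_j=\delta_{ij}I$.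 For $\mathbf n\in\mathbb N^d$ (nonnegative integers), $|\mathbf n|=\sum n_i$, $L^{(\mathbf n)}$ is the sum of all distinct words (products) in the $L_i$ containing exactly $n_i$ factors $L_i$ for each $i$; $L^{(\mathbf 0)}=I$. $\mathcal S$ is the norm-closed linear span of all $L^{(\mathbf n)}$, $\mathcal S^*$ the set of adjoints of its elements, and $\mathcal S_0=\mathrm{span}\{L^{(\mathbf n)}:|\mathbf n|\ge1\}$. Put $z\mathbf L^*=\sum_j z_jL_j^*$. A state on $\mathcal S+\mathcal S^*$ means a positive linear functional (not necessarily normalized), identified with its unique positive extension to the norm closure, which contains $q^*p$ for all $p,q\in\mathcal S$. The state $\mu$ represents $b$ if $$\frac{1+b(z)}{1-b(z)}=\mu\big((I+z\mathbf L^* )(I-z\mathbf L^* )^{-1}\big)+i\,\mathrm{Im}\Big(\frac{1+b(0)}{1-b(0)}\Big),\quad z\in\mathbb B^d;$$ such a $\mu$ exists and is unique. $P^2(\mu)$ is the Hilbert space obtained from $\mathcal S$ with the pre-inner product $\langle p,q\rangle=\mu(q^*p)$ by quotienting null vectors and completing; $[p]$ is the class of $p$. $P^2_0(\mu)$ is the closed span of $\{[p]:p\in\mathcal S_0\}$. The state $\mu$ is quasi-extreme if $P^2_0(\mu)=P^2(\mu)$, and $b$ is quasi-extreme if the state $\mu$ representing it is quasi-extreme. *)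

(* Defs.v *)
From HB Require Import structures.
From mathcomp Require Import all_boot all_order all_algebra.
From mathcomp Require Import complex.
From mathcomp Require Import all_classical all_reals.
From mathcomp Require Import topology normedtype derive.

Set Implicit Arguments.
Unset Strict Implicit.
Unset Printing Implicit Defensive.

Import Order.TTheory GRing.Theory Num.Theory.
Import numFieldNormedType.Exports.

Local Open Scope classical_set_scope.
Local Open Scope ring_scope.

(* The order on [R[i]] is the partial order of a numClosedFieldType:
   [x <= y] says that [y - x] is a nonnegative real; norms of vectors are
   elements of [R[i]] of this kind. *)

(* A complex Hilbert space; the inner product is linear in its first argument. *)
HB.mixin Record isHilbert (R : realType) H
    & CompleteNormedModule R[i] H := {
  inner : H -> H -> R[i];
  innerDZl : forall (a : R[i]) (u v w : H),
    inner (a *: u + v) w = a * inner u w + inner v w;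
  innerC : forall u v : H, inner v u = (inner u v)^*;
  inner_norm : forall u : H, inner u u = `|u| ^+ 2
}.

#[short(type="hilbertType")]
HB.structure Definition Hilbert (R : realType) :=
  {H of isHilbert R H & CompleteNormedModule R[i] H}.

Section Operators.
Context {R : realType} {H : hilbertType R}.
Implicit Types (T A B : H -> H) (E : set (H -> H)).

Definition bounded_op T : Prop :=
  linear T /\ exists M : R[i], forall u, `|T u| <= M * `|u|.

(* For bounded [T] the vector chosen at each [v] exists and is unique
   (Riesz). *)
Definition adj T : H -> H :=
  fun v => xget 0 [set w | forall u, inner (T u) v = inner u w].

(* The inverse, when [T] is bijective. *)
Definition op_inv T : H -> H := 'pinv_(fun=> 0) setT T.

Definition op_pos A : Prop := forall h, 0 <= inner (A h) h.

Definition op_le A B : Prop := op_pos (B - A).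

Definition rank1 (u v : H) : H -> H := fun h => inner h v *: u.

(* Closure for the operator norm, among the bounded operators. *)
Definition op_closure E : set (H -> H) :=
  [set A | bounded_op A /\ forall e : R[i], 0 < e ->
     exists2 B, E B & forall h, `|A h - B h| <= e * `|h|].

End Operators.

Definition lin_span {K : nzRingType} {V : lmodType K} (E : set V) : set V :=
  [set v | exists n (c : 'I_n -> K) (e : 'I_n -> V),
     (forall i, E (e i)) /\ v = \sum_(i < n) c i *: e i].

Section Functions_on_the_ball.
Context {R : realType} {d : nat}.
Implicit Types (z w : 'rV[R[i]]_d) (b : 'rV[R[i]]_d -> R[i]).

Definition zdot z w : R[i] := \sum_(j < d) z ord0 j * (w ord0 j)^*.

(* The Euclidean unit ball: the library norm on ['rV_d] is the sup norm. *)
Definition unit_ball : set 'rV[R[i]]_d := [set z | zdot z z < 1].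

(* Functions on the ball are represented by total functions on [C^d], whose
   values outside of the ball are never used. *)
Definition holomorphic b : Prop :=
  forall z : ('rV[R[i]]_d : normedModType R[i]), unit_ball z ->
    differentiable (b : ('rV[R[i]]_d : normedModType R[i]) -> R[i]^o) z.

Definition da_kernel z w : R[i] := (1 - zdot z w)^-1.

Definition dbr_kernel b z w : R[i] :=
  (1 - b z * (b w)^*) / (1 - zdot z w).

End Functions_on_the_ball.

(* A reproducing kernel Hilbert space of functions on [D] with kernel [k]: the
   vector [f] is the function [rk_eval f] restricted to [D], and [rk_fun w] is
   the kernel function at [w].  It is unique up to the unitary preserving
   [rk_eval] on [D]. *)
Record rkhs (R : realType) (T : Type) (D : set T) (k : T -> T -> R[i]) := {
  rk_space :> hilbertType R;
  rk_eval : rk_space -> T -> R[i];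
  rk_fun : T -> rk_space;
  rk_evalDZ : forall (a : R[i]) (f g : rk_space) z, D z ->
    rk_eval (a *: f + g) z = a * rk_eval f z + rk_eval g z;
  rk_eval_inj : forall f g : rk_space,
    (forall z, D z -> rk_eval f z = rk_eval g z) -> f = g;
  rk_funE : forall w z, D w -> D z -> rk_eval (rk_fun w) z = k z w;
  rk_reproducing : forall (f : rk_space) w, D w ->
    rk_eval f w = inner f (rk_fun w)
}.

Definition drury_arveson (R : realType) (d : nat) :=
  rkhs (@unit_ball R d) (@da_kernel R d).

Definition deBranges_rovnyak (R : realType) (d : nat)
  (b : 'rV[R[i]]_d -> R[i]) := rkhs (@unit_ball R d) (dbr_kernel b).

Definition contractive_multiplier (R : realType) (d : nat)
    (H2 : drury_arveson R d) (b : 'rV[R[i]]_d -> R[i]) : Prop :=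
  holomorphic b /\
  forall f : H2, exists2 g : H2,
    forall z, unit_ball z -> rk_eval g z = b z * rk_eval f z & `|g| <= `|f|.

Section Gleason.
Context {R : realType} {d : nat} {b : 'rV[R[i]]_d -> R[i]}.
Context {Hb : deBranges_rovnyak b}.
Implicit Types X : 'I_d -> Hb -> Hb.

Definition gleason_solution X : Prop :=
  (forall j, bounded_op (X j)) /\
  forall (f : Hb) z, unit_ball z ->
    rk_eval f z - rk_eval f 0 = \sum_(j < d) z ord0 j * rk_eval (X j f) z.

Definition defect : Hb -> Hb :=
  idfun - rank1 (rk_fun Hb 0) (rk_fun Hb 0).

Definition contractive_solution X : Prop :=
  gleason_solution X /\ op_le (\sum_(j < d) (adj (X j) \o X j)) defect.

Definition extremal_solution X : Prop :=
  contractive_solution X /\ \sum_(j < d) (adj (X j) \o X j) = defect.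

End Gleason.

(* [l^2] of the free semigroup of words [seq 'I_d], as a Hilbert space with an
   orthonormal basis indexed by words, and the left creation operators. *)
Record fock (R : realType) (d : nat) := {
  fk_space :> hilbertType R;
  fk_xi : seq 'I_d -> fk_space;
  fk_L : 'I_d -> fk_space -> fk_space;
  fk_orthonormal : forall v w, inner (fk_xi v) (fk_xi w) = (v == w)%:R;
  fk_dense : closure (lin_span (range fk_xi)) = setT;
  fk_L_bounded : forall i, bounded_op (fk_L i);
  fk_L_xi : forall i w, fk_L i (fk_xi w) = fk_xi (i :: w)
}.

Section States.
Context {R : realType} {d : nat} (F : fock R d).
Implicit Types (n : 'I_d -> nat) (mu : (F -> F) -> R[i]).

Definition L_word (w : seq 'I_d) : F -> F :=
  foldr (fun i A => fk_L i \o A) idfun w.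

Definition L_sym n : F -> F :=
  \sum_(w : (\sum_(i < d) n i).-tuple 'I_d |
        [forall i, count_mem i w == n i]) L_word w.

Definition opS : set (F -> F) := op_closure (lin_span (range L_sym)).

Definition opS0 : set (F -> F) :=
  lin_span [set L_sym n | n in [set n | (0 < \sum_(i < d) n i)%N]].

Definition opSstar : set (F -> F) := (@adj R F) @` opS.

(* The norm closure of [S + S^*]. *)
Definition opSys : set (F -> F) :=
  op_closure [set A + B | A in opS & B in opSstar].

(* A state, given directly as its positive extension to the norm closure of
   [S + S^*], not necessarily normalized; the values of [mu] outside of
   [opSys] are never used. *)
Definition is_state mu : Prop :=
  (forall (a : R[i]) A B, opSys A -> opSys B ->
     mu (a *: A + B) = a * mu A + mu B) /\
  (forall A, opSys A -> op_pos A -> 0 <= mu A).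

Definition zLstar (z : 'rV[R[i]]_d) : F -> F :=
  \sum_(j < d) z ord0 j *: adj (fk_L (f := F) j).

Definition represents mu (b : 'rV[R[i]]_d -> R[i]) : Prop :=
  forall z, unit_ball z ->
    (1 + b z) / (1 - b z) =
      mu ((idfun + zLstar z) \o op_inv (idfun - zLstar z))
      + 'i * 'Im ((1 + b 0) / (1 - b 0)).

(* The Hilbert space [P^2(mu)]: a complete space in which [S], with the
   pre-inner product [mu (q^* p)], has a dense isometric image.  This
   determines the completed quotient up to a unitary preserving classes. *)
Record P2 mu := {
  p2_space :> hilbertType R;
  p2_class : (F -> F) -> p2_space;
  p2_classDZ : forall (a : R[i]) p q, opS p -> opS q ->
    p2_class (a *: p + q) = a *: p2_class p + p2_class q;
  p2_inner : forall p q, opS p -> opS q ->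
    inner (p2_class p) (p2_class q) = mu (adj q \o p);
  p2_dense : closure (p2_class @` opS) = setT
}.

Definition P20 mu (P : P2 mu) : set P :=
  closure (lin_span (p2_class P @` opS0)).
Arguments P20 {mu} P _.

(* Any two models of [P^2(mu)] are isomorphic, so the choice of the model
   is immaterial; likewise for the state below, which is unique. *)
Definition quasi_extreme_state mu : Prop :=
  exists P : P2 mu, P20 P = setT.

Definition quasi_extreme (b : 'rV[R[i]]_d -> R[i]) : Prop :=
  exists mu, [/\ is_state mu, represents mu b & quasi_extreme_state mu].

End States.

(* Main.v *)
Require Import Defs.
From HB Require Import structures.
From mathcomp Require Import all_boot all_order all_algebra.
From mathcomp Require Import complex.
From mathcomp Require Import all_classical all_reals.
From mathcomp Require Import topology normedtype derive.
From mathcomp Require Import ring.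

Set Implicit Arguments.
Unset Strict Implicit.
Unset Printing Implicit Defensive.

Import Order.TTheory GRing.Theory Num.Theory.
Import numFieldNormedType.Exports.

Local Open Scope classical_set_scope.
Local Open Scope ring_scope.

(** Write k_z for the kernel functions of H(b).  Given finitely many points z_i
of the ball and coefficients c_i, let h = sum_i c_i k_(z_i), let
g_j = sum_i c_i (z_i)_j^* k_(z_i) for j = 1..d, alpha = sum_i c_i and
beta = sum_i c_i b(z_i)^*.  The formula for the kernel gives
<<
  sum_j |g_j|^2 = |h|^2 - |alpha|^2 + |beta|^2,   <h, k_0> = alpha - b(0) beta
>>
([inner_coord], [inner_comb_kern0]).  Suppose that beta = 0 and that X is a
contractive solution.  The Gleason identity yields
sum_j <X_j h, g_j> = |h|^2 - |<h, k_0>|^2, which is also sum_j |g_j|^2, so that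
sum_j |X_j h - g_j|^2 = sum_j |X_j h|^2 - |h|^2 + |<h, k_0>|^2 <= 0, and
X_j h = g_j ([contractive_coord]).  If the vectors h with beta = 0 are dense,
this determines X and makes the contractivity inequality an equality
([coord_unique], [sum_adj_eq_defect]).  Conversely h |-> g_j is then
contractive and densely defined, and its continuous extension is a solution
([coord_solution_exists], [coord_contractive]).

The density is where quasi-extremity enters: it suffices to find combinations
with beta = 1 and |h| arbitrarily small ([b_free_dense]).  On Fock space let
A_z = sum_j z_j^* L_j and let G_z = (I - A_z)^(-1), an element of S.  Since
A_z^* A_w is the scalar zw^*, one has
(1 - zw^* ) G_z^* G_w = G_z^* + G_w - I ([adj_resolvent_comp]), and the Herglotz
representation of b turns this into
<<
  <[G_w], [G_z]> = k^b(z,w) / ((1 - b(z)) (1 - b(w)^* ))     in P^2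
>>
([gram_resolvent]).  Norms of combinations of the [G_z] are therefore norms of
combinations of the k_z / (1 - b(z)^* ) in H(b).

The classes of L^(n), for |n| >= 1, lie in the closed span of the differences
[G_z] - [I] ([P20_sub_differences]): expanding G_(tz) in powers of t isolates
the powers of A_z one after the other, and the symmetrized words L^(n) are
combinations of values of these powers, by a Vandermonde argument at the points
with coordinates t^(N^j).  Quasi-extremity thus puts [I] = [G_0] in this closed
span; in H(b) this means that there are combinations with alpha - beta = 1 and
|h| arbitrarily small ([small_combination]).  For these, <h, k_0> = alpha - b(0) beta
is small too, so that beta is close to -1 / (1 - b(0)), and dividing by beta
gives the combinations that were needed ([small_beta]). *)

(** * Inner products *)

Section Hilbert_basics.
Context {R : realType} {H : hilbertType R}.
Implicit Types (u v w x y : H) (a : R[i]).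

Lemma innerDl u v w : inner (u + v) w = inner u w + inner v w.
Proof. by rewrite -[u]scale1r innerDZl mul1r scale1r. Qed.

Lemma inner0l w : inner (0 : H) w = 0.
Proof. by apply: (addrI (inner 0 w)); rewrite -innerDl !addr0. Qed.

Lemma innerZl a u w : inner (a *: u) w = a * inner u w.
Proof. by rewrite -[a *: u]addr0 innerDZl inner0l addr0. Qed.

Lemma innerNl u w : inner (- u) w = - inner u w.
Proof. by rewrite -scaleN1r innerZl mulN1r. Qed.

Lemma innerBl u v w : inner (u - v) w = inner u w - inner v w.
Proof. by rewrite innerDl innerNl. Qed.

Lemma innerDr u v w : inner w (u + v) = inner w u + inner w v.
Proof. by rewrite ![inner w _]innerC innerDl rmorphD. Qed.

Lemma inner0r w : inner w (0 : H) = 0.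
Proof. by rewrite innerC inner0l rmorph0. Qed.

Lemma innerZr a u w : inner w (a *: u) = a^* * inner w u.
Proof. by rewrite ![inner w _]innerC innerZl rmorphM. Qed.

Lemma innerNr u w : inner w (- u) = - inner w u.
Proof. by rewrite ![inner w _]innerC innerNl rmorphN. Qed.

Lemma innerBr u v w : inner w (u - v) = inner w u - inner w v.
Proof. by rewrite innerDr innerNr. Qed.

Lemma inner_suml I (r : seq I) (P : pred I) (f : I -> H) w :
  inner (\sum_(i <- r | P i) f i) w = \sum_(i <- r | P i) inner (f i) w.
Proof. by elim/big_rec2: _ => [|i x y _ <-]; rewrite ?inner0l ?innerDl. Qed.

Lemma inner_sumr I (r : seq I) (P : pred I) (f : I -> H) w :
  inner w (\sum_(i <- r | P i) f i) = \sum_(i <- r | P i) inner w (f i).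
Proof. by elim/big_rec2: _ => [|i x y _ <-]; rewrite ?inner0r ?innerDr. Qed.

Lemma inner_ge0 u : 0 <= inner u u.
Proof. by rewrite inner_norm exprn_ge0. Qed.

Lemma inner_eq0 u : inner u u = 0 -> u = 0.
Proof. by rewrite inner_norm => /eqP; rewrite sqrf_eq0 normr_eq0 => /eqP. Qed.

Lemma eq_inner u v : (forall w, inner u w = inner v w) -> u = v.
Proof.
move=> uv; apply/subr0_eq/inner_eq0.
by rewrite innerBl uv subrr.
Qed.

Lemma sqr_normB u v :
  `|u - v| ^+ 2 = `|u| ^+ 2 - inner u v - (inner u v)^* + `|v| ^+ 2.
Proof.
rewrite -!inner_norm innerBl !innerBr (innerC u v).
by ring.
Qed.

Lemma parallelogram u v :
  `|u + v| ^+ 2 + `|u - v| ^+ 2 = 2 * `|u| ^+ 2 + 2 * `|v| ^+ 2.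
Proof.
rewrite -[in X in X + _](opprK v) !sqr_normB normrN innerNr rmorphN.
by ring.
Qed.

(** The vector subtracted from [u] is its projection on the line of [v], so
    this is the Pythagorean identity; it serves both for the Cauchy-Schwarz
    inequality and for the orthogonality of nearest points. *)
Lemma sqr_norm_residual u v : v != 0 ->
  `|u - (inner u v / `|v| ^+ 2) *: v| ^+ 2
    = `|u| ^+ 2 - `|inner u v| ^+ 2 / `|v| ^+ 2.
Proof.
move=> v0; have n0 : `|v| != 0 by rewrite normr_eq0.
have cn : (`|v| ^- 2)^* = `|v| ^- 2.
  by apply: conj_Creal; rewrite rpredV rpredX // normr_real.
rewrite sqr_normB innerZr normrZ exprMn !normrM normrV ?unitfE ?expf_neq0 //.
rewrite normrX normr_id !rmorphM /= !cn conjCK !exprMn [`|inner u v| ^+ 2]normCK.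
by field.
Qed.

Lemma cauchy_schwarz u v : `|inner u v| <= `|u| * `|v|.
Proof.
have [->|v0] := eqVneq v 0; first by rewrite inner0r !normr0 mulr0.
have n0 : 0 < `|v| by rewrite normr_gt0.
rewrite -ler_pdivrMr // -ler_sqr ?nnegrE ?divr_ge0 // -subr_ge0.
by rewrite expr_div_n -sqr_norm_residual // exprn_ge0.
Qed.

End Hilbert_basics.

(** * Limits, closures and linear subspaces *)

Section Limits.
Context {R : realType}.
Local Notation C := R[i].

Lemma le_eps (x y : C) : x \is Num.real -> y \is Num.real ->
  (forall e, 0 < e -> x <= y + e) -> x <= y.
Proof.
move=> xr yr xy; rewrite real_leNgt //; apply/negP => yx.
have /xy : 0 < (x - y) / 2 by rewrite divr_gt0 ?subr_gt0.
rewrite -subr_ge0 (_ : _ - x = - ((x - y) / 2)); last by field.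
by rewrite oppr_ge0 real_leNgt ?rpred0 ?divr_gt0 ?subr_gt0 // rpred_div ?rpredB ?realn.
Qed.

Lemma norm_eps_eq0 (V : normedModType C) (x : V) (c : C) : 0 <= c ->
  (forall e, 0 < e -> `|x| <= c * e) -> x = 0.
Proof.
move=> c0 xe; apply/normr0_eq0/le_anti; rewrite normr_ge0 andbT.
apply: le_eps; rewrite ?normr_real ?rpred0 // => e e0; rewrite add0r.
have c1 : 0 < c + 1 by rewrite ltr_wpDl.
apply: (le_trans (xe (e / (c + 1)) _)); first by rewrite divr_gt0.
rewrite mulrCA ger_pMr // ler_pdivrMr // mul1r lerDl.
by [].
Qed.

Lemma small_inv (e : C) : 0 < e -> exists n : nat, n.+1%:R^-1 < e.
Proof.
move=> e0; have er := RRe_real (gtr0_real e0).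
have e0' : 0 < complex.Re e by rewrite -ltcR er.
exists (Num.bound (complex.Re e)^-1).
have h : (complex.Re e)^-1 < (Num.bound (complex.Re e)^-1)%:R.
  by rewrite archi_boundP // invr_ge0 ltW.
rewrite -er invf_plt ?posrE ?ltr0n ?ltcR // -fmorphV -(rmorph_nat (real_complex R)) ltcR.
by rewrite (lt_trans h) // ltr_nat.
Qed.

(** Completeness with an explicit rate, which is kept by the limit. *)
Lemma cauchy_seq_lim (V : completeNormedModType C) (u : nat -> V) (e : nat -> C) :
  (forall n m, (n <= m)%N -> `|u m - u n| <= e n) ->
  (forall r, 0 < r -> exists n, e n < r) ->
  exists l, forall n, `|l - u n| <= e n.
Proof.
move=> ue e0; have cu : cvg (u @ \oo).
  apply/cauchy_cvgP/cauchy_exP => r r0; have [n en] := e0 r r0.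
  exists (u n); exists n => // m /= nm; rewrite -ball_normE /=.
  by rewrite distrC (le_lt_trans (ue _ _ nm)).
exists (lim (u @ \oo)) => n; apply: le_eps; first exact: normr_real.
  by have := ue n n (leqnn n); rewrite subrr normr0 => /ger0_real.
move=> r r0; have /cvgrPdist_lt/(_ r r0)[N _ NP] := cu.
have := NP (maxn n N) (leq_maxr _ _) => /= h.
rewrite -(subrK (u (maxn n N)) (lim _)) -addrA (le_trans (ler_normD _ _)) //.
by rewrite [e n + r]addrC; apply: lerD; [exact: ltW|rewrite ue // leq_maxl].
Qed.

Lemma closureP (V : normedModType C) (A : set V) x :
  closure A x <-> forall e, 0 < e -> exists2 y, A y & `|x - y| < e.
Proof.
split=> [cA e e0|h B].
  have [|y [Ay By]] := cA (ball x e); first exact: nbhsx_ballx.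
  by exists y => //; move: By; rewrite -ball_normE.
move=> /nbhs_ballP[e /= e0 eB]; have [y Ay xy] := h e e0.
by exists y; split=> //; apply: eB; rewrite -ball_normE.
Qed.

End Limits.

Definition linear_subspace {K : nzRingType} {V : lmodType K} (W : set V) : Prop :=
  W 0 /\ forall a u v, W u -> W v -> W (a *: u + v).

Section Subspaces.
Context {K : nzRingType} {V : lmodType K} (W : set V).
Hypothesis sW : linear_subspace W.

Lemma subspaceD u v : W u -> W v -> W (u + v).
Proof. by move=> Wu Wv; rewrite -[u]scale1r; apply: sW.2. Qed.

Lemma subspaceZ a u : W u -> W (a *: u).
Proof. by move=> Wu; rewrite -[_ *: _]addr0; apply: sW.2 => //; apply: sW.1. Qed.

Lemma subspaceB u v : W u -> W v -> W (u - v).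
Proof. by move=> Wu Wv; rewrite addrC -scaleN1r; apply: sW.2. Qed.

Lemma subspace_sum I (r : seq I) (P : pred I) (f : I -> V) :
  (forall i, P i -> W (f i)) -> W (\sum_(i <- r | P i) f i).
Proof.
by move=> Wf; apply: big_rec => [|i x Pi Wx]; [exact: sW.1|exact: subspaceD (Wf _ Pi) Wx].
Qed.

Lemma lin_span_sub (E : set V) : E `<=` W -> lin_span E `<=` W.
Proof.
by move=> EW v [n [c [e [Ee ->]]]]; apply: subspace_sum => i _; apply/subspaceZ/EW.
Qed.

End Subspaces.

Lemma subspace_lin_span {K : nzRingType} {V : lmodType K} (E : set V) :
  linear_subspace (lin_span E).
Proof.
split; first by exists 0%N, (fun=> 0), (fun=> 0); split; [case|rewrite big_ord0].
move=> a _ _ [n [c [e [Ee ->]]]] [m [c' [e' [Ee' ->]]]].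
pose s T (f : 'I_n -> T) (g : 'I_m -> T) i :=
  match fintype.split i with inl j => f j | inr j => g j end.
exists (n + m)%N, (s _ (fun i => a * c i) c'), (s _ e e'); split.
  by move=> i; rewrite /s; case: fintype.split => j.
rewrite big_split_ord /= scaler_sumr; congr (_ + _); apply: eq_bigr => i _.
  by rewrite /s (unsplitK (inl i)) scalerA.
by rewrite /s (unsplitK (inr i)).
Qed.

Lemma lin_span_gen {K : nzRingType} {V : lmodType K} (E : set V) v :
  E v -> lin_span E v.
Proof.
move=> Ev; exists 1%N, (fun=> 1), (fun=> v); split=> //.
by rewrite big_ord1 scale1r.
Qed.

Lemma subspace_closure {R : realType} (V : normedModType R[i]) (W : set V) :
  linear_subspace W -> linear_subspace (closure W).
Proof.
move=> sW; split; first exact/subset_closure/sW.1.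
move=> a u v /closureP Wu /closureP Wv; apply/closureP => e e0.
have a1 : 0 < `|a| + 1 by rewrite ltr_wpDl.
have [u' Wu' uu'] := Wu (e / 2 / (`|a| + 1)) (divr_gt0 (divr_gt0 e0 (ltr0n _ 2)) a1).
have [v' Wv' vv'] := Wv (e / 2) (divr_gt0 e0 (ltr0n _ 2)).
exists (a *: u' + v'); first exact: sW.2.
rewrite opprD addrACA -scalerBr (le_lt_trans (ler_normD _ _)) // normrZ.
rewrite [e](splitr e) ltr_leD // ?(ltW vv') //.
have h : `|a| * `|u - u'| <= `|a| * (e / 2 / (`|a| + 1)).
  by rewrite ler_wpM2l // ltW.
rewrite (le_lt_trans h) // mulrCA gtr_pMr ?divr_gt0 //.
by rewrite ltr_pdivrMr // mul1r ltrDl.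
Qed.

(** * Orthogonal projection, the Riesz theorem and adjoints *)

Section Projection.
Context {R : realType} {H : hilbertType R}.
Local Notation C := R[i].

(** A minimizing sequence for the distance to [x] is Cauchy by the
    parallelogram identity, because midpoints stay in [W].  Orthogonality is
    read off along this sequence: by [sqr_norm_residual], a component of
    [x - u n] along some [w] of [W] would bring a vector of [W] closer to [x]
    than the infimum allows. *)
Lemma projection (W : set H) : linear_subspace W -> closure W `<=` W ->
  forall x, exists2 p, W p & forall w, W w -> inner (x - p) w = 0.
Proof.
move=> sW cW x.
have rE (w : H) : (complex.Re (`|x - w| ^+ 2))%:C%C = `|x - w| ^+ 2.
  by apply: RRe_real; rewrite rpredX // normr_real.
pose E : set R := [set complex.Re (`|x - w| ^+ 2) | w in W].
have E_lb : lbound E 0.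
  by move=> _ [w _ <-]; rewrite -lecR rE exprn_ge0.
have E_inf : has_inf E by split; [exists (complex.Re (`|x - 0| ^+ 2)), 0 => //; exact: sW.1|exists 0].
pose delta : C := (inf E)%:C%C.
have deltaP w : W w -> delta <= `|x - w| ^+ 2.
  by move=> Ww; rewrite -rE lecR ge_inf //; [exists 0|exists w].
pose eta n : C := n.+1%:R^-1.
have eta0 n : 0 < eta n by rewrite invr_gt0 ltr0n.
have eta_le n m : (n <= m)%N -> eta m <= eta n.
  by move=> nm; rewrite lef_pV2 ?posrE ?ltr0n // ler_nat ltnS.
have near_inf n : exists w, W w /\ `|x - w| ^+ 2 <= delta + eta n ^+ 2 / 4.
  have er := RRe_real (gtr0_real (divr_gt0 (exprn_gt0 2 (eta0 n)) (ltr0n C 4))).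
  have e0 : 0 < complex.Re (eta n ^+ 2 / 4) by rewrite -ltcR er divr_gt0 ?exprn_gt0.
  have [_ [w Ww <-] wlt] := inf_adherent e0 E_inf.
  by exists w; split=> //; rewrite -er -rE /delta -rmorphD /= lecR ltW.
have [u uP] := choice near_inf.
have [|r r0|p pP] := @cauchy_seq_lim R H u eta.
- move=> n m nm; have [Wn un] := uP n; have [Wm um] := uP m.
  rewrite -ler_sqr ?nnegrE ?(ltW (eta0 n)) //.
  (* the midpoint of [u n] and [u m] lies in [W] *)
  have mid : delta <= `|x - 2^-1 *: (u n + u m)| ^+ 2.
    by apply/deltaP/(subspaceZ sW)/(subspaceD sW).
  have := parallelogram (x - u n) (x - u m).
  rewrite (_ : x - u n - (x - u m) = u m - u n); last first.
    by rewrite opprB addrC addrA subrK.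
  rewrite (_ : x - u n + (x - u m) = 2 *: (x - 2^-1 *: (u n + u m))); last first.
    rewrite scalerBr scalerA divff ?pnatr_eq0 // scale1r scaler_nat mulr2n.
    by rewrite addrACA opprD.
  rewrite normrZ exprMn normr_nat => par.
  have em : eta m ^+ 2 <= eta n ^+ 2 by rewrite ler_sqr ?nnegrE ?(ltW (eta0 _)) // eta_le.
  have -> : `|u m - u n| ^+ 2 = 2 * `|x - u n| ^+ 2 + 2 * `|x - u m| ^+ 2
      - 2 ^+ 2 * `|x - 2^-1 *: (u n + u m)| ^+ 2 by rewrite -par addrAC subrr add0r.
  have h1 : 2 * `|x - u n| ^+ 2 <= 2 * (delta + eta n ^+ 2 / 4) by rewrite ler_wpM2l.
  have h2 : 2 * `|x - u m| ^+ 2 <= 2 * (delta + eta n ^+ 2 / 4).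
    by rewrite ler_wpM2l // (le_trans um) // lerD2l ler_wpM2r // invr_ge0.
  have h3 : 2 ^+ 2 * delta <= 2 ^+ 2 * `|x - 2^-1 *: (u n + u m)| ^+ 2.
    by rewrite ler_wpM2l // exprn_ge0.
  apply: (le_trans (lerB (lerD h1 h2) h3)).
  by rewrite le_eqVlt; apply/orP; left; apply/eqP; field.
- by have [n nr] := small_inv r0; exists n.
exists p.
  apply/cW/closureP => e e0; have [n nr] := small_inv e0.
  by exists (u n); [exact: (uP n).1|exact: le_lt_trans (pP n) nr].
move=> w Ww; have [->|w0] := eqVneq w 0; first by rewrite inner0r.
have nw : 0 < `|w| by rewrite normr_gt0.
apply: (@norm_eps_eq0 R C^o _ (2 * `|w|)) => [|e e0]; first by rewrite mulr_ge0.
have [n ne] := small_inv e0; have [Wn un] := uP n.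
have -> : inner (x - p) w = inner (x - u n) w - inner (p - u n) w.
  by rewrite -innerBl opprB addrA subrK.
rewrite (le_trans (ler_normB _ _)) // -mulrA mulrDl mul1r lerD //; last first.
  by rewrite (le_trans (cauchy_schwarz _ _)) // mulrC ler_wpM2l // (le_trans (pP n)) // ltW.
have : delta <= `|x - u n - (inner (x - u n) w / `|w| ^+ 2) *: w| ^+ 2.
  by rewrite -addrA -opprD; apply/deltaP/(subspaceD sW)=> //; apply/(subspaceZ sW).
rewrite sqr_norm_residual // => dn.
have : `|inner (x - u n) w| ^+ 2 / `|w| ^+ 2 <= eta n ^+ 2 / 4.
  rewrite -(lerD2l delta); apply: le_trans un; rewrite -lerBrDr. exact: dn.
move=> h; have : (`|inner (x - u n) w| / `|w|) ^+ 2 <= eta n ^+ 2.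
  rewrite expr_div_n (le_trans h) // ler_pdivrMr // ler_peMr ?exprn_ge0 ?(ltW (eta0 n)) //.
  by rewrite ler1n.
rewrite ler_sqr ?nnegrE ?divr_ge0 ?(ltW (eta0 n)) // ler_pdivrMr // mulrC => h'.
by rewrite (le_trans h') // ler_wpM2l // ltW.
Qed.

(** A vector orthogonal to the closed kernel of [phi] represents [phi] up to
    a scalar, since the kernel has codimension at most one. *)
Lemma riesz (phi : H -> C) (M : C) :
  (forall a u v, phi (a *: u + v) = a * phi u + phi v) ->
  (forall u, `|phi u| <= M * `|u|) ->
  exists w, forall u, phi u = inner u w.
Proof.
move=> phiL phiM.
have phi0 : phi 0 = 0.
  by apply/normr0_eq0/le_anti; rewrite normr_ge0 (le_trans (phiM 0)) // normr0 mulr0.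
have phiZ a u : phi (a *: u) = a * phi u by rewrite -[a *: u]addr0 phiL phi0 addr0.
have phiB u v : phi (u - v) = phi u - phi v.
  by rewrite addrC -scaleN1r phiL mulN1r addrC.
pose W := [set u | phi u = 0].
have sW : linear_subspace W by split=> // a u v /= u0 v0; rewrite /W /= phiL u0 v0 mulr0 addr0.
have cW : closure W `<=` W.
  move=> x /closureP Wx; apply: (@norm_eps_eq0 R C^o _ `|M|) => // e e0.
  have [y Wy xy] := Wx e e0.
  rewrite -[phi x]subr0 -Wy -phiB (le_trans (phiM _)) //.
  have: M * `|x - y| \is Num.real by apply/ger0_real/(le_trans (normr_ge0 _) (phiM _)).
  move=> /real_ler_norm h; rewrite (le_trans h) // normrM normr_id ler_wpM2l //.
  exact: ltW.
have [phi_eq0|/existsNP[x0 phix0]] := pselect (forall u, phi u = 0).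
  by exists 0 => u; rewrite inner0r.
have [p Wp orth] := projection sW cW x0.
set y := x0 - p in orth.
have phiy : phi y != 0 by rewrite phiB Wp subr0; apply/eqP.
have y0 : y != 0 by apply: contraNneq phiy => ->; rewrite phi0.
exists (((phi y)^* / `|y| ^+ 2) *: y) => u.
have : inner y (u - (phi u / phi y) *: y) = 0.
  by apply: orth; rewrite /W /= phiB phiZ divfK // subrr.
rewrite innerBr innerZr inner_norm => /subr0_eq/(congr1 Num.conj).
rewrite -innerC rmorphM /= conjCK => yu.
rewrite innerZr rmorphM /= conjCK yu rmorphXn /= fmorphV rmorphXn /=.
rewrite (conj_Creal (normr_real _)).
by field; rewrite phiy normr_eq0 y0.
Qed.

End Projection.

Section Bounded_operators.
Context {R : realType} {H : hilbertType R}.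
Local Notation C := R[i].
Implicit Types (S T : H -> H).

Lemma bounded_opP T : bounded_op T ->
  linear T /\ exists2 M : C, 0 < M & forall u, `|T u| <= M * `|u|.
Proof.
move=> [lT [M MP]]; split=> //; exists (`|M| + 1); first by rewrite ltr_wpDl.
move=> u; have: M * `|u| \is Num.real by apply/ger0_real/(le_trans (normr_ge0 _) (MP _)).
move=> /real_ler_norm h; rewrite (le_trans (MP u)) // (le_trans h) //.
by rewrite normrM normr_id ler_wpM2r // lerDl.
Qed.

Lemma bounded_op0 : bounded_op (0 : H -> H).
Proof.
split; first by move=> a u v; rewrite /= scaler0 addr0.
by exists 0 => u; rewrite normr0 mul0r.
Qed.

Lemma bounded_op_id : bounded_op (idfun : H -> H).
Proof. by split=> //; exists 1 => u; rewrite mul1r. Qed.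

Lemma bounded_opDZ a S T : bounded_op S -> bounded_op T -> bounded_op (a *: S + T).
Proof.
move=> /bounded_opP[lS [M M0 MP]] /bounded_opP[lT [N N0 NP]]; split.
  move=> c u v; rewrite /= !fctE lS lT !scalerDr !scalerA addrACA.
  by rewrite [a * c]mulrC.
exists (`|a| * M + N) => u; rewrite mulrDl -mulrA.
by rewrite (le_trans (ler_normD _ _)) // lerD // normrZ ler_wpM2l.
Qed.

Lemma subspace_bounded_op   : linear_subspace (@bounded_op R H).
Proof. by split; [exact: bounded_op0|exact: bounded_opDZ]. Qed.

Lemma bounded_op_comp S T : bounded_op S -> bounded_op T -> bounded_op (S \o T).
Proof.
move=> /bounded_opP[lS [M M0 MP]] /bounded_opP[lT [N N0 NP]]; split.
  by move=> c u v; rewrite /= lT lS.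
exists (M * N) => u; rewrite -mulrA (le_trans (MP _)) // ler_wpM2l //.
exact: ltW.
Qed.

(** The adjoint is a chosen vector; the Riesz theorem shows that the choice
    is made in a nonempty set. *)
Lemma adjP T u v : bounded_op T -> inner (T u) v = inner u (adj T v).
Proof.
move=> /bounded_opP[lT [M M0 MP]]; suff: exists w, forall u, inner (T u) v = inner u w.
  by move=> ex; have := xgetPex 0 ex; apply.
apply: (@riesz R H _ (M * `|v|)) => [a x y|x]; first by rewrite lT innerDZl.
by rewrite (le_trans (cauchy_schwarz _ _)) // mulrAC ler_wpM2r.
Qed.

Lemma adjPr T u v : bounded_op T -> inner v (T u) = inner (adj T v) u.
Proof. by move=> bT; rewrite innerC adjP // -innerC. Qed.

Lemma adj_unique S T : bounded_op T ->
  (forall u v, inner (T u) v = inner u (S v)) -> adj T = S.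
Proof.
move=> bT ST; apply/funext => v; apply: eq_inner => w.
by rewrite innerC -adjP // ST -innerC.
Qed.

Lemma norm_adj T (M : C) u : 0 <= M -> bounded_op T ->
  (forall u, `|T u| <= M * `|u|) -> `|adj T u| <= M * `|u|.
Proof.
move=> M0 bT MP; have [->|n0] := eqVneq (adj T u) 0; first by rewrite normr0 mulr_ge0.
have n0' : 0 < `|adj T u| by rewrite normr_gt0.
rewrite -(ler_pM2l n0') -expr2 -inner_norm -adjPr //.
have -> : inner u (T (adj T u)) = `|inner u (T (adj T u))|.
  by rewrite ger0_norm // adjPr // inner_ge0.
apply: (le_trans (cauchy_schwarz _ _)).
by rewrite [leRHS]mulrA [leRHS]mulrC ler_wpM2l // mulrC MP.
Qed.

Lemma bounded_op_adj T : bounded_op T -> bounded_op (adj T).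
Proof.
move=> bT; split.
  move=> a u v; apply: eq_inner => w.
  by rewrite -adjPr // !innerDZl !adjPr.
have [_ [M M0 MP]] := bounded_opP bT.
by exists M => u; apply: norm_adj => //; apply: ltW.
Qed.

End Bounded_operators.

(** * Operator closures, Neumann series and dense sets *)

Section Operator_closure.
Context {R : realType} {H : hilbertType R}.
Local Notation C := R[i].
Implicit Types (S T : H -> H) (E : set (H -> H)).

Lemma linear_op_closure E : linear_subspace E -> linear_subspace (op_closure E).
Proof.
move=> sE; split.
  split=> [|e e0]; first exact: bounded_op0.
  by exists 0 => [|h]; [exact: sE.1|rewrite subr0 normr0 mulr_ge0 // ltW].
move=> a S T [bS clS] [bT clT]; split; first exact: bounded_opDZ.
move=> e e0; have a1 : 0 < `|a| + 1 by rewrite ltr_wpDl.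
have [S' ES' SS'] := clS (e / 2 / (`|a| + 1)) (divr_gt0 (divr_gt0 e0 (ltr0n _ 2)) a1).
have [T' ET' TT'] := clT (e / 2) (divr_gt0 e0 (ltr0n _ 2)).
exists (a *: S' + T') => [|h]; first exact: sE.2.
rewrite (_ : _ - _ = a *: (S h - S' h) + (T h - T' h)); last first.
  by rewrite !fctE scalerBr opprD addrACA.
rewrite (le_trans (ler_normD _ _)) // normrZ [e]splitr mulrDl lerD //.
rewrite (le_trans (ler_wpM2l _ (SS' h))) // mulrA ler_wpM2r // mulrCA.
by rewrite ger_pMr ?divr_gt0 // ler_pdivrMr // mul1r lerDl.
Qed.

Lemma sub_op_closure E : E `<=` @bounded_op R H -> E `<=` op_closure E.
Proof.
move=> Eb T ET; split; first exact: Eb.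
by move=> e e0; exists T => // h; rewrite subrr normr0 mulr_ge0 // ltW.
Qed.

End Operator_closure.

Section Neumann_series.
Context {R : realType} {H : hilbertType R}.
Local Notation C := R[i].
Variables (T : H -> H) (r : C).
Hypotheses (linT : linear T) (r0 : 0 <= r) (r1 : r < 1).
Hypothesis Tr : forall u, `|T u| <= r * `|u|.

Let TB u v : T (u - v) = T u - T v.
Proof. by rewrite addrC -scaleN1r linT scaleN1r addrC. Qed.

Let TD u v : T (u + v) = T u + T v.
Proof. by rewrite -[u in LHS]scale1r linT scale1r. Qed.

Let T0 : T 0 = 0.
Proof. by have := TB 0 0; rewrite !subrr. Qed.

Let q0 : 0 < 1 - r. Proof. by rewrite subr_gt0. Qed.

Lemma small_expr (e : C) : 0 < e -> exists n : nat, r ^+ n < e.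
Proof.
move=> e0; have bernoulli n : r ^+ n * (1 + n%:R * (1 - r)) <= 1.
  elim: n => [|n IHn]; first by rewrite expr0 mul0r addr0 mul1r.
  apply: le_trans IHn; rewrite exprSr -mulrA ler_wpM2l ?exprn_ge0 //.
  rewrite -subr_ge0 (_ : _ - _ = (n.+1%:R) * (1 - r) ^+ 2).
    by rewrite mulr_ge0 // exprn_ge0 // ltW.
  by rewrite -natr1; ring.
have [n] := small_inv (mulr_gt0 e0 q0).
rewrite -ltr_pdivrMr // => n_lt; exists n.+1; apply: le_lt_trans n_lt.
have d0 : 0 < n.+1%:R * (1 - r) by rewrite mulr_gt0 ?ltr0n.
rewrite -invfM -[leRHS]mul1r ler_pdivlMr //; apply: le_trans (bernoulli n.+1).
by rewrite ler_wpM2l ?exprn_ge0 // lerDr.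
Qed.

(** Strict contractions have no nonzero fixed vector; the linearity of the
    sum of the Neumann series and its commutation with [T] both follow from
    this. *)
Lemma fixed_eq0 x : x = T x -> x = 0.
Proof.
move=> xT; apply/eqP; rewrite -normr_le0 -(pmulr_rle0 _ q0) mulrBl mul1r.
by rewrite subr_le0 {1}xT.
Qed.

Lemma norm_iter n u : `|iter n T u| <= r ^+ n * `|u|.
Proof.
elim: n => [|n IHn]; first by rewrite expr0 mul1r.
by rewrite iterS (le_trans (Tr _)) // exprS -mulrA ler_wpM2l.
Qed.

Let partial u n := \sum_(k < n) iter k T u.

Lemma partial_sum_cauchy u n m : (n <= m)%N ->
  `|partial u m - partial u n| <= r ^+ n / (1 - r) * `|u|.
Proof.
move=> /subnKC <-; set k := (m - n)%N.
suff h : `|partial u (n + k) - partial u n| <= (r ^+ n - r ^+ (n + k)) / (1 - r) * `|u|.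
  apply: (le_trans h); rewrite ler_wpM2r // ler_pM2r ?invr_gt0 //.
  by rewrite gerBl exprn_ge0.
elim: k => [|k IHk]; first by rewrite addn0 !subrr normr0 !mul0r.
rewrite addnS {1}/partial big_ord_recr /= -/(partial u (n + k)) addrAC.
rewrite (le_trans (ler_normD _ _)) // (le_trans (lerD IHk (norm_iter _ _))) //.
rewrite -mulrDl ler_wpM2r // exprS le_eqVlt; apply/orP; left; apply/eqP.
set x := r ^+ (n + k); set y := r ^+ n.
by field; rewrite gt_eqF.
Qed.

(** The sum of the geometric series of [T] at each vector, with the rate of
    convergence that shows it to be a limit in operator norm. *)
Lemma neumann : exists G : H -> H, [/\ bounded_op G,
  forall u, G u = u + T (G u), forall u, G u = u + G (T u) &
  forall n u, `|G u - \sum_(k < n) iter k T u| <= r ^+ n / (1 - r) * `|u|].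
Proof.
have lim u : exists l, forall n, `|l - partial u n| <= r ^+ n / (1 - r) * `|u|.
  apply: cauchy_seq_lim; first exact: partial_sum_cauchy.
  move=> e e0; have c0 : 0 < (1 - r)^-1 * (`|u| + 1).
    by rewrite mulr_gt0 ?invr_gt0 // ltr_wpDl.
  have [n nP] := small_expr (divr_gt0 e0 c0); exists n.
  rewrite ltr_pdivlMr // in nP; apply: le_lt_trans nP.
  by rewrite mulrA ler_wpM2l ?mulr_ge0 ?exprn_ge0 ?invr_ge0 ?(ltW q0) // lerDl.
have [G GP] := choice lim.
have Gfix u : G u = u + T (G u).
  apply/eqP; rewrite -subr_eq0; apply/eqP.
  apply: (@norm_eps_eq0 _ _ _ (2 * ((1 - r)^-1 * `|u|))) => [|e e0].
    by rewrite !mulr_ge0 ?invr_ge0 ?(ltW q0).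
  have [n nP] := small_expr e0.
  have pS : partial u n.+1 = u + T (partial u n).
    rewrite /partial big_ord_recl /=; congr (_ + _).
    by elim/big_rec2: _ => [|i x y _ ->]; rewrite ?T0 ?TD.
  have -> : G u - (u + T (G u)) = (G u - partial u n.+1) - T (G u - partial u n).
    by rewrite TB pS opprB !opprD !addrA subrK.
  rewrite (le_trans (ler_normB _ _)) // -!mulrA mulrDl mul1r.
  have h : r ^+ n / (1 - r) * `|u| <= (1 - r)^-1 * (`|u| * e).
    rewrite -mulrA [leLHS]mulrC [leRHS]mulrA ler_wpM2l ?mulr_ge0 ?invr_ge0 ?(ltW q0) //.
    exact: ltW.
  apply: lerD; apply: le_trans h.
    rewrite (le_trans (GP u n.+1)) // -!mulrA.
    rewrite ler_wpM2r ?mulr_ge0 ?invr_ge0 ?(ltW q0) //.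
    by rewrite exprS ler_piMl ?exprn_ge0 // ltW.
  rewrite (le_trans (Tr _)) // (le_trans (ler_wpM2l r0 (GP u n))) //.
  rewrite ler_piMl ?mulr_ge0 ?exprn_ge0 ?invr_ge0 ?(ltW q0) //.
  exact: ltW.
exists G; split=> //.
- split.
    move=> a u v; apply/eqP; rewrite -subr_eq0; apply/eqP/fixed_eq0.
    rewrite [in LHS]Gfix [in LHS](Gfix u) [in LHS](Gfix v).
    by rewrite TB linT scalerDr addrACA opprD addrACA subrr add0r.
  exists (1 - r)^-1 => u; rewrite mulrC ler_pdivlMr // mulrBr mulr1 lerBlDr.
  by rewrite {1}Gfix (le_trans (ler_normD _ _)) // lerD // mulrC.
- move=> u; apply/eqP; rewrite eq_sym -subr_eq0; apply/eqP/fixed_eq0.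
  rewrite TB TD {1}(Gfix (T u)) {1}(Gfix u).
  by rewrite opprD addrACA subrr add0r.
- by move=> n u; apply: GP.
Qed.

End Neumann_series.

Section Density.
Context {R : realType} {H : hilbertType R}.
Local Notation C := R[i].
Implicit Types (E D : set H).

Lemma dense_orthogonal_eq0 E x : closure (lin_span E) = setT ->
  (forall e, E e -> inner e x = 0) -> x = 0.
Proof.
move=> dE Ex; have : closure (lin_span E) x by rewrite dE.
have spanx u : lin_span E u -> inner u x = 0.
  move=> [n [c [e [Ee ->]]]]; rewrite inner_suml big1 // => i _.
  by rewrite innerZl Ex // mulr0.
move=> /closureP xE; apply: (@norm_eps_eq0 _ _ _ 1) => // e e0; rewrite mul1r.
have [->|x0] := eqVneq x 0; first by rewrite normr0 ltW.
have [y Ey xy] := xE e e0; have nx : 0 < `|x| by rewrite normr_gt0.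
rewrite -(ler_pM2r nx) -expr2 -inner_norm.
have -> : inner x x = `|inner (x - y) x|.
  by rewrite innerBl (spanx y) // subr0 ger0_norm // inner_ge0.
by rewrite (le_trans (cauchy_schwarz _ _)) // ler_wpM2r // ltW.
Qed.

Lemma dense_op_eq0 E (T : H -> H) : closure (lin_span E) = setT -> bounded_op T ->
  (forall e, E e -> T e = 0) -> forall u, T u = 0.
Proof.
move=> dE /bounded_opP[lT [M M0 MP]] ET u; have : closure (lin_span E) u by rewrite dE.
move=> /closureP uE; apply: (@norm_eps_eq0 _ _ _ M) => [|e e0]; first exact: ltW.
have [y Ey uy] := uE e e0.
have Ty : T y = 0.
  apply: (@lin_span_sub _ _ [set v | T v = 0] _ E _ y Ey); last exact: ET.
  split=> [|a v w /= v0 w0]; last by rewrite /= lT v0 w0 scaler0 addr0.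
  by have := lT (-1) 0 0; rewrite /= !scaleN1r !addNr.
have -> : T u = T (u - y) by rewrite addrC -scaleN1r lT Ty scaler0 add0r.
by rewrite (le_trans (MP _)) // ler_wpM2l ?ltW.
Qed.

End Density.

Lemma op_invE {R : realType} {H : hilbertType R} (S T : H -> H) :
  cancel T S -> cancel S T -> op_inv T = S.
Proof.
move=> TS ST; apply/funext => y; rewrite -[LHS]TS /op_inv pinvK //.
by rewrite inE /=; exists (S y).
Qed.

(** * The unit ball and the creation operators *)

Section Ball.
Context {R : realType} {d : nat}.
Local Notation C := R[i].
Implicit Types (z w : 'rV[C]_d).

Lemma zdot_ge0 z : 0 <= zdot z z.
Proof. by apply: sumr_ge0 => j _; rewrite mul_conjC_ge0. Qed.

Lemma zdotZ a z : zdot (a *: z) (a *: z) = `|a| ^+ 2 * zdot z z.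
Proof.
rewrite /zdot mulr_sumr; apply: eq_bigr => j _.
by rewrite !mxE rmorphM /= normCK mulrACA.
Qed.

Lemma zdot0l z : zdot 0 z = 0.
Proof. by rewrite /zdot big1 // => j _; rewrite mxE mul0r. Qed.

Lemma unit_ball0 : unit_ball (0 : 'rV[C]_d).
Proof. by rewrite /unit_ball /= zdot0l. Qed.

Lemma zdot_lt1 z w : unit_ball z -> unit_ball w -> `|zdot z w| < 1.
Proof.
move=> Bz Bw; apply: (@le_lt_trans _ _ ((zdot z z + zdot w w) / 2)); last first.
  by rewrite ltr_pdivrMr // mul1r mulr2n ltrD.
rewrite ler_pdivlMr // mulrC mulr_natl -[leLHS]mulr_natl.
apply: (@le_trans _ _ (2 * \sum_(j < d) `|z ord0 j| * `|w ord0 j|)).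
  rewrite ler_wpM2l // (le_trans (ler_norm_sum _ _ _)) //.
  by apply: ler_sum => j _; rewrite normrM norm_conjC.
rewrite mulr_sumr -big_split /=; apply: ler_sum => j _.
rewrite -!normCK -subr_ge0.
have -> : `|z ord0 j| ^+ 2 + `|w ord0 j| ^+ 2 - 2 * (`|z ord0 j| * `|w ord0 j|)
  = (`|z ord0 j| - `|w ord0 j|) ^+ 2 by ring.
by rewrite real_exprn_even_ge0 // rpredB // normr_real.
Qed.

Lemma zdot_neq1 z w : unit_ball z -> unit_ball w -> 1 - zdot z w != 0.
Proof.
move=> Bz Bw; rewrite subr_eq0; apply: contraTneq (zdot_lt1 Bz Bw) => <-.
by rewrite normr1 ltxx.
Qed.

End Ball.

Section Creation.
Context {R : realType} {d : nat} (F : fock R d).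
Local Notation C := R[i].
Implicit Types (z w : 'rV[C]_d) (u v : F).

(** The conjugates make [adj (creation z)] the operator [zLstar z]; as a
    function of [z], the operator is antiholomorphic. *)
Definition creation z : F -> F := \sum_(j < d) (z ord0 j)^* *: fk_L j.

Lemma creationE z u : creation z u = \sum_(j < d) (z ord0 j)^* *: fk_L j u.
Proof. by rewrite /creation fct_sumE. Qed.

Lemma bounded_creation z : bounded_op (creation z).
Proof.
apply: (subspace_sum subspace_bounded_op) => j _.
exact/(subspaceZ subspace_bounded_op)/fk_L_bounded.
Qed.

(** Both sides are bounded, and they agree on the orthonormal basis of words. *)
Lemma adjL_L i j u : adj (fk_L i) (fk_L j u) = (i == j)%:R *: u :> F.
Proof.
pose T : F -> F := (- (i == j)%:R) *: idfun + (adj (fk_L i) \o fk_L j).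
suff /(_ u) : forall u, T u = 0.
  by rewrite /T /= !fctE /= addrC scaleNr => /subr0_eq.
apply: (dense_op_eq0 (fk_dense F)).
  apply: bounded_opDZ; first exact: bounded_op_id.
  by apply: bounded_op_comp; [apply: bounded_op_adj|]; apply: fk_L_bounded.
move=> _ [w _ <-]; apply: (dense_orthogonal_eq0 (fk_dense F)) => _ [v _ <-].
rewrite /T /= !fctE /= innerDr innerZr -adjP; last exact: fk_L_bounded.
rewrite !fk_L_xi !fk_orthonormal eqseq_cons rmorphN /= conjC_nat -mulnb natrM.
by rewrite mulNr addNr.
Qed.

Lemma inner_creation z w u v :
  inner (creation z u) (creation w v) = zdot w z * inner u v.
Proof.
rewrite !creationE inner_suml /zdot mulr_suml; apply: eq_bigr => i _.
rewrite inner_sumr (bigD1 i) //= big1 ?addr0 => [|j ji].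
  rewrite innerZl innerZr conjCK adjP ?adjL_L; last exact: fk_L_bounded.
  by rewrite eqxx scale1r mulrCA mulrA.
rewrite innerZl innerZr adjP ?adjL_L; last exact: fk_L_bounded.
by rewrite eq_sym (negPf ji) scale0r inner0r !mulr0.
Qed.

Lemma norm_creation z u : `|creation z u| = sqrtC (zdot z z) * `|u|.
Proof.
apply/eqP; rewrite -(@eqrXn2 _ 2) ?mulr_ge0 ?sqrtC_ge0 ?zdot_ge0 //.
by rewrite exprMn sqrtCK -!inner_norm inner_creation.
Qed.

Lemma adj_creation z : adj (creation z) = (zLstar z : F -> F).
Proof.
apply: adj_unique => [|u v]; first exact: bounded_creation.
rewrite creationE /zLstar fct_sumE inner_suml inner_sumr; apply: eq_bigr => j _.
by rewrite innerZl innerZr adjP //; apply: fk_L_bounded.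
Qed.

(** The operator denoted G_z in the introduction. *)
Definition resolvent z : F -> F := op_inv (idfun - creation z).

Lemma sqrt_zdot_lt1 z : unit_ball z -> sqrtC (zdot z z) < 1.
Proof. by move=> Bz; rewrite -sqrtC1 ltr_sqrtC // ?qualifE /= ?zdot_ge0. Qed.

Lemma resolvent_spec z : unit_ball z -> [/\ bounded_op (resolvent z),
  forall u, resolvent z u = u + creation z (resolvent z u),
  forall u, resolvent z u = u + resolvent z (creation z u) &
  forall n u, `|resolvent z u - \sum_(k < n) iter k (creation z) u|
    <= sqrtC (zdot z z) ^+ n / (1 - sqrtC (zdot z z)) * `|u|].
Proof.
move=> Bz; have [lA _] := bounded_creation z.
have r0 : 0 <= sqrtC (zdot z z) by rewrite sqrtC_ge0 zdot_ge0.
have Ar u : `|creation z u| <= sqrtC (zdot z z) * `|u| by rewrite norm_creation.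
have [G [bG fixG GA tail]] := neumann lA r0 (sqrt_zdot_lt1 Bz) Ar.
suff -> : resolvent z = G by [].
have [lG _] := bG.
apply: op_invE => u.
  by rewrite /= !fctE /= addrC -scaleN1r lG scaleN1r addrC {1}(GA u) addrK.
by rewrite /= !fctE /= {1}fixG addrK.
Qed.

Section Resolvents_at.
Variables (z w : 'rV[C]_d).
Hypotheses (Bz : unit_ball z) (Bw : unit_ball w).

Lemma bounded_resolvent : bounded_op (resolvent z).
Proof. by have [] := resolvent_spec Bz. Qed.

Lemma resolvent_fix u : resolvent z u = u + creation z (resolvent z u).
Proof. by have [_ fG _ _] := resolvent_spec Bz; apply: fG. Qed.

Lemma op_inv_zLstar : op_inv (idfun - (zLstar z : F -> F)) = adj (resolvent z).
Proof.
have bG := bounded_resolvent; have bA := bounded_creation z.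
apply: op_invE => v; apply: eq_inner => u; rewrite /= !fctE /= -adj_creation.
  rewrite innerC -adjP // innerBr -adjP // -innerBl {1}resolvent_fix addrK.
  by rewrite -innerC.
have [_ _ GA _] := resolvent_spec Bz.
rewrite innerC innerBr -!adjP // -innerBl {1}GA addrK.
by rewrite -innerC.
Qed.

(** Expand [inner (A_w G_w u) (A_z G_z v)], with A the creation operators and
    G the resolvents, in two ways: by [inner_creation], and by A G = G - I. *)
Lemma inner_resolvent u v : (1 - zdot z w) * inner (resolvent w u) (resolvent z v)
  = inner u (resolvent z v) + (inner (resolvent w u) v - inner u v).
Proof.
have [_ fz _ _] := resolvent_spec Bz; have [_ fw _ _] := resolvent_spec Bw.
have Az : creation z (resolvent z v) = resolvent z v - v by rewrite {2}fz addrC addKr.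
have Aw : creation w (resolvent w u) = resolvent w u - u by rewrite {2}fw addrC addKr.
rewrite mulrBl mul1r -inner_creation Az Aw !innerBl !innerBr.
by ring.
Qed.

End Resolvents_at.

(** The product, a priori a new kind of operator, is a combination of an
    element of S and of an adjoint of such an element; this is what makes the
    Gram matrix of the resolvents in P^2 computable from the Herglotz
    representation. *)
Lemma adj_resolvent_comp z w : unit_ball z -> unit_ball w ->
  adj (resolvent z) \o resolvent w =
  (1 - zdot z w)^-1 *: adj (resolvent z) + (1 - zdot z w)^-1 *: (resolvent w - idfun).
Proof.
move=> Bz Bw; have bG := bounded_resolvent Bz.
rewrite -scalerDr; apply/funext => u; apply: eq_inner => v.
rewrite /= !fctE /= innerZl innerDl innerBl -!adjPr //.
apply: (mulfI (zdot_neq1 Bz Bw)); rewrite mulVKf ?zdot_neq1 //.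
exact: inner_resolvent.
Qed.

Lemma creationZ a z u : creation (a *: z) u = a^* *: creation z u.
Proof.
rewrite !creationE scaler_sumr; apply: eq_bigr => j _.
by rewrite mxE rmorphM scalerA.
Qed.

Lemma iter_creationZ k a z u :
  iter k (creation (a *: z)) u = (a^*) ^+ k *: iter k (creation z) u.
Proof.
elim: k => [|k IHk]; first by rewrite expr0 scale1r.
have [lA _] := bounded_creation z.
rewrite !iterS IHk creationZ -[X in creation z X]addr0 lA.
by have := lA (-1) 0 0; rewrite !scaleN1r !addNr => ->; rewrite addr0 scalerA -exprS.
Qed.

End Creation.

(** * Powers of creation operators and symmetrized words *)

(** The coefficients of a vector polynomial are combinations of its values at
    sufficiently many points. *)
Lemma vandermonde_subspace {K : fieldType} {V : lmodType K} (W : set V)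
    (m : nat) (x : 'I_m -> K) (S : 'I_m -> V) :
  linear_subspace W -> injective x ->
  (forall t, W (\sum_(i < m) x t ^+ i *: S i)) -> forall i, W (S i).
Proof.
move=> sW x_inj WS i.
pose M := Vandermonde m (\row_t x t).
have uM : M \in unitmx.
  rewrite unitmxE det_Vandermonde unitfE; apply/prodf_neq0 => k _.
  apply/prodf_neq0 => j kj; rewrite !mxE subr_eq0.
  by apply: contraTneq kj => /x_inj ->; rewrite ltnn.
have -> : S i = \sum_t invmx M t i *: \sum_(j < m) x t ^+ j *: S j.
  under eq_bigr do rewrite scaler_sumr.
  rewrite exchange_big (bigD1 i) //= [X in _ + X]big1 ?addr0 => [|j ji].
    under eq_bigr do rewrite scalerA.
    rewrite -scaler_suml (_ : \sum_t _ = (M *m invmx M) i i); last first.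
      by rewrite !mxE; apply: eq_bigr => t _; rewrite !mxE mulrC.
    by rewrite mulmxV // mxE eqxx scale1r.
  under eq_bigr do rewrite scalerA.
  rewrite -scaler_suml (_ : \sum_t _ = (M *m invmx M) j i); last first.
    by rewrite !mxE; apply: eq_bigr => t _; rewrite !mxE mulrC.
  by rewrite mulmxV // mxE (negPf ji) scale0r.
apply: (subspace_sum sW) => t _; exact/(subspaceZ sW)/WS.
Qed.

Section Counting.
Context {d : nat}.
Implicit Types (w : seq 'I_d).

Lemma prod_count {K : comNzRingType} (f : 'I_d -> K) w :
  \prod_(i <- w) f i = \prod_(j < d) f j ^+ count_mem j w.
Proof.
elim: w => [|i w IHw]; first by rewrite big_nil big1.
rewrite big_cons IHw; under [RHS]eq_bigr do rewrite /= exprD.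
rewrite big_split /=; congr (_ * _).
rewrite (bigD1 i) //= big1 ?mulr1 ?eqxx ?expr1 // => j /negPf.
by rewrite eq_sym => ->.
Qed.

Lemma sum_count (f : 'I_d -> nat) w :
  (\sum_(i <- w) f i = \sum_(j < d) count_mem j w * f j)%N.
Proof.
elim: w => [|i w IHw]; first by rewrite big_nil big1.
rewrite big_cons IHw; under [RHS]eq_bigr do rewrite /= mulnDl.
rewrite big_split /=; congr addn; rewrite (bigD1 i) //= big1 ?addn0 ?eqxx ?mul1n //.
by move=> j /negPf; rewrite eq_sym => ->.
Qed.

Lemma sum_count_mem w : (\sum_(j < d) count_mem j w = size w)%N.
Proof.
have := sum_count (fun=> 1%N) w; under [in RHS]eq_bigr do rewrite muln1.
by move=> <-; rewrite sum1_size.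
Qed.

End Counting.

Lemma digits_inj (N d : nat) (f g : 'I_d -> nat) :
  (forall j, f j < N)%N -> (forall j, g j < N)%N ->
  (\sum_(j < d) f j * N ^ j = \sum_(j < d) g j * N ^ j)%N -> f =1 g.
Proof.
elim: d f g => [|d IHd] f g fN gN; first by move=> _ [].
rewrite !big_ord_recl /= !expn0 !muln1.
have shift (h : 'I_d.+1 -> nat) : (\sum_(i < d) h (lift ord0 i) * N ^ bump 0 i
    = (\sum_(i < d) h (lift ord0 i) * N ^ i) * N)%N.
  by rewrite big_distrl /=; apply: eq_bigr => i _; rewrite /bump /= add1n expnSr mulnA.
rewrite !shift => fg.
have N0 : (0 < N)%N by apply: leq_ltn_trans (fN ord0).
have fg0 : f ord0 = g ord0.
  by have /(congr1 (modn^~ N)) := fg; rewrite /= ![(_ + _ * N)%N]addnC !modnMDl !modn_small.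
move: fg; rewrite fg0 => /addnI/eqP; rewrite eqn_pmul2r // => /eqP fg j.
have fgl := IHd _ _ (fun j => fN (lift ord0 j)) (fun j => gN (lift ord0 j)) fg.
by case: (unliftP ord0 j) => [i ->|->]; [exact: fgl|].
Qed.

Section Words.
Context {R : realType} {d : nat} (F : fock R d).
Local Notation C := R[i].
Implicit Types (z w : 'rV[C]_d) (u v : F) (n : 'I_d -> nat).

Lemma bounded_L_word (s : seq 'I_d) : bounded_op (L_word s : F -> F).
Proof.
elim: s => [|i s IHs]; first exact: bounded_op_id.
by apply: bounded_op_comp => //; apply: fk_L_bounded.
Qed.

Lemma bounded_L_sym n : bounded_op (L_sym n : F -> F).
Proof. by apply: (subspace_sum subspace_bounded_op) => w _; apply: bounded_L_word. Qed.

Lemma L_symE n k : (\sum_(i < d) n i)%N = k ->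
  L_sym n = \sum_(w : k.-tuple 'I_d | [forall i, count_mem i w == n i]) L_word w :> (F -> F).
Proof. by move=> <-. Qed.

Lemma iter_creation k z : iter k (creation z) =
  \sum_(w : k.-tuple 'I_d) (\prod_(i <- w) (z ord0 i)^*) *: L_word w :> (F -> F).
Proof.
elim: k => [|k IHk].
  rewrite (big_pred1 [tuple]) => [|w]; last by apply/esym/eqP; rewrite [w]tuple0.
  by rewrite big_nil scale1r.
apply/funext => u; rewrite iterS IHk creationE !fct_sumE.
rewrite (reindex (fun p : 'I_d * k.-tuple 'I_d => [tuple of p.1 :: p.2])) /=; last first.
  exists (fun t => (thead t, [tuple of behead t])) => [[i w] _|t _] /=.
    by congr pair; apply/val_inj.
  by rewrite -tuple_eta.
rewrite -(pair_bigA _ (fun i (w : k.-tuple 'I_d) =>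
  ((\prod_(j <- i :: w) (z ord0 j)^*) *: L_word (i :: w)) u)) /=.
apply: eq_bigr => i _; have [lL _] := fk_L_bounded F i.
rewrite -[\sum_(w <- _) _]addr0 -[X in fk_L i X]scale1r.
have L0 : fk_L i (0 : F) = 0.
  by have := lL (-1) 0 0; rewrite !scaleN1r !addNr.
have LD u1 u2 : fk_L i (u1 + u2 : F) = fk_L i u1 + fk_L i u2.
  by have := lL 1 u1 u2; rewrite !scale1r.
rewrite scale1r addr0 (big_morph _ LD L0) scaler_sumr; apply: eq_bigr => w _.
have LZ a x : fk_L i (a *: x : F) = a *: fk_L i x by rewrite -[a *: x]addr0 lL L0 addr0.
by rewrite /= !fctE LZ scalerA big_cons.
Qed.

(** The coefficient of a word in the power depends only on the numbers of
    occurrences of the letters, so equal coefficients group into symmetrized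
    words. *)
Lemma iter_creation_span k z :
  lin_span (range (@L_sym R d F)) (iter k (creation z)).
Proof.
have sS := subspace_lin_span (range (@L_sym R d F)).
pose p (w : k.-tuple 'I_d) := [ffun j => inord (count_mem j w)] : {ffun 'I_d -> 'I_k.+1}.
have pE (w : k.-tuple 'I_d) j : p w j = count_mem j w :> nat.
  by rewrite ffunE inordK // ltnS -{2}(size_tuple w) count_size.
rewrite iter_creation (partition_big p xpredT) //=.
apply: (subspace_sum sS) => f _.
have -> : \sum_(w : k.-tuple 'I_d | p w == f) (\prod_(i <- w) (z ord0 i)^*) *: L_word w =
  (\prod_(j < d) (z ord0 j)^* ^+ f j) *: \sum_(w : k.-tuple 'I_d | p w == f) (L_word w : F -> F).
  rewrite scaler_sumr; apply: eq_bigr => w /eqP <-; congr (_ *: _).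
  by rewrite prod_count; apply: eq_bigr => j _; rewrite pE.
apply: (subspaceZ sS).
have pfE (w : k.-tuple 'I_d) : (p w == f) = [forall i, count_mem i w == f i].
  apply/eqP/forallP => [<- i|wf]; first by rewrite pE.
  by apply/ffunP => i; apply/val_inj; rewrite /= pE; apply/eqP.
rewrite (eq_bigl _ _ pfE).
have [fk|fk] := eqVneq (\sum_(i < d) f i)%N k.
  by rewrite -(@L_symE (fun i => f i : nat)) //; apply: lin_span_gen; exists (fun i => f i : nat).
rewrite big_pred0 => [|w]; first exact: sS.1.
apply: contraNF fk => /forallP wf.
by rewrite -[eqbRHS](size_tuple w) -sum_count_mem; apply/eqP/eq_bigr => i _; apply/eqP; rewrite eq_sym.
Qed.

(** At the point z = (t^(N^j))_j, with N larger than the length of the words,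
    the coefficient of a word in the power of [creation z] is t^e, where the
    base N digits of e are the letter counts.  Different counts thus give
    different exponents, and [vandermonde_subspace] in the one variable t
    separates the symmetrized words. *)
Lemma L_sym_in_subspace (W : set (F -> F)) n : linear_subspace W ->
  (forall z, W (iter (\sum_(i < d) n i) (creation z))) -> W (L_sym n).
Proof.
move=> sW WA; set k := (\sum_(i < d) n i)%N in WA; pose N := k.+1.
pose e (s : seq 'I_d) := (\sum_(i <- s) N ^ i)%N.
have e_le (w : k.-tuple 'I_d) : (e w <= k * N ^ d)%N.
  rewrite -{2}(size_tuple w) /e; elim: (val w) => [|i s IHs]; first by rewrite big_nil.
  by rewrite big_cons mulSn leq_add // leq_pexp2l // ltnW.
pose m := (k * N ^ d).+1.
pose S (i : 'I_m) : F -> F := \sum_(w : k.-tuple 'I_d | e w == i) L_word w.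
have n_le j : (n j < N)%N by rewrite ltnS /k (bigD1 j) //= leq_addr.
have WS : forall i, W (S i).
  apply: (@vandermonde_subspace _ _ W m (fun t : 'I_m => (t : nat)%:R)) => // [t1 t2|t].
    by move=> /eqP; rewrite eqr_nat => /eqP/val_inj.
  have := WA (\row_j (t : nat)%:R ^+ (N ^ j)); congr W.
  rewrite iter_creation (partition_big (fun w : k.-tuple 'I_d => inord (e w) : 'I_m) xpredT) //=.
  apply: eq_bigr => i _; rewrite /S scaler_sumr.
  have eE (w : k.-tuple 'I_d) : (inord (e w) == i :> 'I_m) = (e w == i).
    by rewrite -val_eqE /= inordK // ltnS.
  rewrite (eq_bigl _ _ eE); apply: eq_bigr => w /eqP <-; congr (_ *: _).
  by rewrite /e -prodrXr; apply: eq_bigr => i0 _; rewrite mxE rmorphXn /= conjC_nat.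
have nm : (\sum_(j < d) n j * N ^ j < m)%N.
  rewrite ltnS /k big_distrl /=; apply: leq_sum => j _.
  by rewrite leq_mul2l leq_pexp2l ?orbT // ltnW.
have := WS (Ordinal nm); congr W; rewrite /S (@L_symE n k) //.
apply: eq_bigl => w /=; rewrite /e sum_count.
apply/eqP/forallP => [ew i|wn]; last by apply: eq_bigr => j _; rewrite (eqP (wn j)).
apply/eqP; apply: (digits_inj _ n_le ew) => j.
by rewrite ltnS -{2}(size_tuple w) count_size.
Qed.

End Words.

(** * The state and its Hilbert space *)

Section State.
Context {R : realType} {d : nat} {F : fock R d}.
Local Notation C := R[i].
Implicit Types (z w : 'rV[C]_d) (p q : F -> F) (u v : F).

Lemma opS_linear : linear_subspace (@opS R d F).
Proof. exact/linear_op_closure/subspace_lin_span. Qed.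

Lemma opS_bounded p : opS p -> bounded_op p.
Proof. by case. Qed.

Lemma lin_span_opS : lin_span (range (@L_sym R d F)) `<=` @opS R d F.
Proof.
apply: sub_op_closure; apply: (lin_span_sub subspace_bounded_op) => _ [n _ <-].
exact: bounded_L_sym.
Qed.

Lemma opS_iter_creation k z : opS (iter k (creation z) : F -> F).
Proof. exact/lin_span_opS/iter_creation_span. Qed.

Lemma opS_id : opS (idfun : F -> F).
Proof. by have := opS_iter_creation 0 0. Qed.

(** The remainder of the Neumann series after its first [k] terms. *)
Definition tail k z : F -> F := fun u => iter k (creation z) (resolvent z u).

Lemma tailS k z : unit_ball z -> tail k.+1 z = tail k z - iter k (creation z).
Proof.
move=> Bz; apply/funext => u; rewrite /tail iterSr !fctE.
have [linA _] := opS_bounded (opS_iter_creation k z).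
have -> : creation z (resolvent z u) = resolvent z u - u.
  by rewrite [in RHS](resolvent_fix Bz) addrC addKr.
by rewrite [resolvent z u - u]addrC -[- u]scaleN1r linA scaleN1r addrC.
Qed.

Lemma opS_resolvent z : unit_ball z -> opS (resolvent z : F -> F).
Proof.
move=> Bz; have [bG _ _ GP] := resolvent_spec F Bz; split=> // e e0.
have r1 := sqrt_zdot_lt1 Bz.
have r0 : 0 <= sqrtC (zdot z z) by rewrite sqrtC_ge0 zdot_ge0.
have q0 : 0 < 1 - sqrtC (zdot z z) by rewrite subr_gt0.
have [n nP] := small_expr r0 r1 (mulr_gt0 e0 q0).
exists (\sum_(k < n) iter k (creation z)).
  by apply: (subspace_sum (subspace_lin_span _)) => k _; apply: iter_creation_span.
move=> h; rewrite fct_sumE (le_trans (GP n h)) // ler_wpM2r //.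
by rewrite ler_pdivrMr // ltW.
Qed.

Lemma opS_tail k z : unit_ball z -> opS (tail k z).
Proof.
move=> Bz; elim: k => [|k IHk]; first exact: opS_resolvent.
by rewrite tailS //; apply: (subspaceB opS_linear) => //; apply: opS_iter_creation.
Qed.

Lemma resolvent_expand n z : unit_ball z ->
  resolvent z = \sum_(k < n) iter k (creation z) + tail n z :> (F -> F).
Proof.
move=> Bz; elim: n => [|n IHn]; first by rewrite big_ord0 add0r.
by rewrite big_ord_recr /= tailS // addrACA addrN addr0 -IHn.
Qed.

Lemma adj0 : adj (0 : F -> F) = 0.
Proof.
apply: adj_unique => [|u v]; first exact: bounded_op0.
exact: etrans (inner0l _) (esym (inner0r _)).
Qed.

Lemma adj_id : adj (idfun : F -> F) = idfun.
Proof. by apply: adj_unique => //; apply: bounded_op_id. Qed.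

Lemma opS_opSys : @opS R d F `<=` @opSys R d F.
Proof.
move=> p Sp; apply: sub_op_closure; last first.
  exists p => //; exists 0; last by rewrite addr0.
  by exists 0; [exact: opS_linear.1|exact: adj0].
move=> _ [A SA [_ [B SB <-] <-]]; apply: (subspaceD subspace_bounded_op).
  exact: opS_bounded.
exact/bounded_op_adj/opS_bounded.
Qed.

Lemma adj_opS_opSys p : opS p -> opSys (adj p).
Proof.
move=> Sp; apply: sub_op_closure; last first.
  exists 0; first exact: opS_linear.1.
  by exists (adj p); [exists p|rewrite add0r].
move=> _ [A SA [_ [B SB <-] <-]]; apply: (subspaceD subspace_bounded_op).
  exact: opS_bounded.
exact/bounded_op_adj/opS_bounded.
Qed.

Section Model.
Variables (mu : (F -> F) -> C) (mu_state : is_state mu) (P : P2 mu).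
Local Notation cls := (p2_class P).
Local Notation one := (cls idfun).

Lemma clsDZ a p q : opS p -> opS q -> cls (a *: p + q) = a *: cls p + cls q.
Proof. exact: p2_classDZ. Qed.

Lemma cls0 : cls 0 = 0.
Proof.
have S0 := opS_linear.1.
by have := clsDZ (-1) S0 S0; rewrite scaler0 addr0 scaleN1r addNr.
Qed.

Lemma clsZ a p : opS p -> cls (a *: p) = a *: cls p.
Proof. by move=> Sp; rewrite -[a *: p]addr0 clsDZ ?cls0 ?addr0 //; apply: opS_linear.1. Qed.

Lemma clsD p q : opS p -> opS q -> cls (p + q) = cls p + cls q.
Proof. by move=> Sp Sq; rewrite -[p]scale1r clsDZ // !scale1r. Qed.

Lemma clsB p q : opS p -> opS q -> cls (p - q) = cls p - cls q.
Proof. by move=> Sp Sq; rewrite addrC -scaleN1r clsDZ // scaleN1r addrC. Qed.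

Lemma cls_sum n (f : 'I_n -> F -> F) : (forall i, opS (f i)) ->
  cls (\sum_(i < n) f i) = \sum_(i < n) cls (f i).
Proof.
elim: n f => [|n IHn] f Sf; first by rewrite !big_ord0 cls0.
rewrite !big_ord_recr clsD ?IHn //.
by apply: (subspace_sum opS_linear) => i _.
Qed.

(** The inner product of P^2 recovers the state on S and on the adjoints of S;
    that the state takes conjugate values at an operator and at its adjoint is
    thereby the symmetry of the inner product. *)
Lemma mu_adjDZ a p q : opS p -> opS q ->
  mu (a *: adj p + q) = a * inner one (cls p) + inner (cls q) one.
Proof.
move=> Sp Sq; rewrite mu_state.1; [|exact: adj_opS_opSys|exact: opS_opSys].
by rewrite !p2_inner ?adj_id //; apply: opS_id.
Qed.

Lemma inner_cls_resolvent z w : unit_ball z -> unit_ball w ->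
  (1 - zdot z w) * inner (cls (resolvent w)) (cls (resolvent z)) =
  inner one (cls (resolvent z)) + inner (cls (resolvent w)) one - inner one one.
Proof.
move=> Bz Bw; rewrite p2_inner; [|exact: opS_resolvent..].
rewrite adj_resolvent_comp // mu_adjDZ; [|exact: opS_resolvent|]; last first.
  apply: (subspaceZ opS_linear); apply: (subspaceB opS_linear).
    exact: opS_resolvent.
  exact: opS_id.
rewrite clsZ ?clsB; [|exact: opS_resolvent|exact: opS_id|]; last first.
  by apply: (subspaceB opS_linear); [exact: opS_resolvent|exact: opS_id].
rewrite innerZl innerBl -mulrDr mulVKf ?zdot_neq1 //.
by rewrite addrA.
Qed.

(** Since [creation z] is an isometry up to the scalar |z|, the operators
    T^* T, for T a remainder and for T the resolvent, are proportional, and so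
    are their values under the state. *)
Lemma norm_cls_tail k z : unit_ball z ->
  `|cls (tail k z)| = sqrtC (zdot z z) ^+ k * `|cls (resolvent z)|.
Proof.
move=> Bz; have Sk := opS_tail k Bz; have SG : opS (resolvent z : F -> F) := opS_resolvent Bz.
apply/eqP; rewrite -(@eqrXn2 _ 2) ?mulr_ge0 ?exprn_ge0 ?sqrtC_ge0 ?zdot_ge0 //.
rewrite exprMn exprAC sqrtCK -!inner_norm.
rewrite !p2_inner // (_ : adj (tail k z) \o _ = zdot z z ^+ k *: (adj (resolvent z) \o resolvent z)).
  have c := zdot_neq1 Bz Bz; rewrite adj_resolvent_comp // scalerDr !scalerA.
  have SGi : opS (resolvent z - idfun : F -> F).
    by apply: (subspaceB opS_linear) => //; apply: opS_id.
  rewrite !mu_adjDZ //; [|exact: (subspaceZ opS_linear)..].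
  by rewrite !clsZ // !innerZl; apply/eqP; ring.
apply/funext => u; apply: eq_inner => v; rewrite /= !fctE innerZl -!adjPr; [|exact: opS_bounded..].
rewrite /tail; elim: k {Sk} => [|k IHk]; first by rewrite expr0 mul1r.
by rewrite !iterS inner_creation IHk exprS mulrA.
Qed.

(** From [resolvent z] = I + (first remainder), the norm x of the class
    satisfies x <= |[I]| + |z| x. *)
Lemma norm_cls_resolvent z : unit_ball z ->
  `|cls (resolvent z)| <= `|one| / (1 - sqrtC (zdot z z)).
Proof.
move=> Bz; have q0 : 0 < 1 - sqrtC (zdot z z) by rewrite subr_gt0 sqrt_zdot_lt1.
rewrite ler_pdivlMr // mulrBr mulr1 lerBlDr.
have h : cls (resolvent z) = one + cls (tail 1 z).
  rewrite {1}(resolvent_expand 1 Bz) big_ord1 clsD //; first exact: opS_id.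
  exact: opS_tail.
rewrite {1}h (le_trans (ler_normD _ _)) // norm_cls_tail // expr1.
by rewrite [_ * sqrtC _]mulrC.
Qed.

Definition resolvent_differences : set P :=
  closure (lin_span [set cls (resolvent z) - one | z in @unit_ball R d]).

Lemma linear_resolvent_differences : linear_subspace resolvent_differences.
Proof. exact/subspace_closure/subspace_lin_span. Qed.

Lemma closure_resolvent_differences :
  closure resolvent_differences = resolvent_differences.
Proof. by apply/esym/closure_id; apply: closed_closure. Qed.

(** With A = [creation z] and 0 < t <= 1, the class of G_(tz) - I minus the terms
    t^i [A^i] for 0 < i <= k, all of which lie in the subspace by induction,
    is t^(k+1) [A^(k+1)] plus a remainder of norm O(t^(k+2)).  Divide by
    t^(k+1) and let t tend to 0. *)
Lemma iter_creation_differences_ball k z : unit_ball z -> (0 < k)%N ->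
  resolvent_differences (cls (iter k (creation z))).
Proof.
move=> Bz; have sQ := linear_resolvent_differences.
elim/ltn_ind: k => -[//|k] IHk _.
rewrite -closure_resolvent_differences.
apply/closureP => e e0.
set r := sqrtC (zdot z z).
have r0 : 0 <= r by rewrite sqrtC_ge0 zdot_ge0.
have q0 : 0 < 1 - r by rewrite subr_gt0 sqrt_zdot_lt1.
have M1 : 0 < `|one| / (1 - r) + 1 by rewrite ltr_wpDl // divr_ge0 // ltW.
have [n nP] := small_inv (divr_gt0 e0 M1).
set t : C := n.+1%:R^-1 in nP.
have t0 : 0 < t by rewrite invr_gt0 ltr0n.
have t1 : t <= 1 by rewrite invf_le1 ?ltr0n // ler1n.
have tn : t != 0 by rewrite gt_eqF.
have tc : t^* = t by apply/conj_Creal/gtr0_real.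
have zt : zdot (t *: z) (t *: z) = t ^+ 2 * zdot z z by rewrite zdotZ gtr0_norm.
have rt : sqrtC (zdot (t *: z) (t *: z)) = t * r.
  by rewrite zt sqrtCM ?qualifE /= ?exprn_ge0 ?zdot_ge0 ?(ltW t0) // sqrCK // ltW.
have Bt : unit_ball (t *: z).
  rewrite /unit_ball /= zt; apply: le_lt_trans Bz.
  by rewrite ler_piMl ?zdot_ge0 // exprn_ile1 // ltW.
have St m : opS (iter m (creation (t *: z)) : F -> F) by apply: opS_iter_creation.
have At m : cls (iter m (creation (t *: z))) = t ^+ m *: cls (iter m (creation z)).
  rewrite -clsZ; last exact: opS_iter_creation.
  by congr cls; apply/funext => u; rewrite iter_creationZ tc.
pose y0 := cls (resolvent (t *: z)) - one
  - \sum_(i < k) t ^+ i.+1 *: cls (iter i.+1 (creation z)).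
have y0E : y0 = t ^+ k.+1 *: cls (iter k.+1 (creation z)) + cls (tail k.+2 (t *: z)).
  rewrite /y0 {1}(resolvent_expand k.+2 Bt) clsD; last exact: opS_tail; last first.
    by apply: (subspace_sum opS_linear) => i _.
  rewrite cls_sum // big_ord_recl big_ord_recr /=.
  rewrite (eq_bigr _ (fun (i : 'I_k) _ => At i.+1)) (At k.+1).
  set S := \sum_(i < k) _; rewrite -[one + _ + _]addrA [one + _]addrC addrK.
  by rewrite -[S + _ + _]addrA [S + _]addrC addrK.
exists (t ^- k.+1 *: y0).
  apply: (subspaceZ sQ); apply: (subspaceB sQ).
    by apply/subset_closure/lin_span_gen; exists (t *: z).
  apply: (subspace_sum sQ) => i _; apply: (subspaceZ sQ); apply: IHk => //.
  by rewrite ltnS.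
rewrite y0E scalerDr scalerA mulVf ?expf_neq0 // scale1r opprD addrA subrr add0r.
rewrite normrN normrZ norm_cls_tail // rt normfV normrX gtr0_norm //.
rewrite (_ : t ^- k.+1 * _ = t * (r ^+ k.+2 * `|cls (resolvent (t *: z))|)); last first.
  rewrite exprMn (exprSr t k.+1); move: (r ^+ k.+2) => rk.
  by rewrite -!mulrA mulKf ?expf_neq0.
have Gb : `|cls (resolvent (t *: z))| <= `|one| / (1 - r).
  apply: (le_trans (norm_cls_resolvent Bt)); rewrite rt ler_wpM2l //.
  rewrite lef_pV2 ?posrE //; first by rewrite lerB // ler_piMl.
  by rewrite subr_gt0; apply: (@le_lt_trans _ _ r); rewrite ?ler_piMl // -subr_gt0.
rewrite ltr_pdivlMr // in nP; apply: le_lt_trans nP; rewrite ler_wpM2l ?(ltW t0) //.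
apply: (@le_trans _ _ (`|one| / (1 - r))); last by rewrite lerDl.
by apply: le_trans Gb; rewrite ler_piMl // exprn_ile1 // ltW // -subr_gt0.
Qed.

(** Powers are homogeneous in [z], so any point can be scaled into the ball. *)
Lemma iter_creation_differences k z : (0 < k)%N ->
  resolvent_differences (cls (iter k (creation z))).
Proof.
move=> k0; pose a : C := (1 + zdot z z)^-1.
have a1 : 0 < 1 + zdot z z by rewrite ltr_wpDr // zdot_ge0.
have a0 : 0 < a by rewrite invr_gt0.
have Ba : unit_ball (a *: z).
  rewrite /unit_ball /= zdotZ gtr0_norm // /a exprVn mulrC ltr_pdivrMr ?exprn_gt0 // mul1r.
  rewrite -subr_gt0 (_ : _ - _ = 1 + zdot z z + zdot z z ^+ 2); last by ring.
  by rewrite ltr_wpDr // exprn_ge0 // zdot_ge0.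
have ac : (a^*) ^+ k != 0 by rewrite expf_neq0 // conjC_eq0 gt_eqF.
have := iter_creation_differences_ball Ba k0.
move=> /(subspaceZ linear_resolvent_differences ((a^*) ^- k)).
congr resolvent_differences.
rewrite -clsZ; last exact: opS_iter_creation.
by congr cls; apply/funext => u; rewrite !fctE iter_creationZ scalerA mulVf // scale1r.
Qed.

Lemma P20_sub_differences : @P20 R d F mu P `<=` resolvent_differences.
Proof.
have sQ := linear_resolvent_differences.
pose W := [set p | opS p /\ resolvent_differences (cls p)].
have sW : linear_subspace W.
  split; first by split; [exact: opS_linear.1|rewrite cls0; exact: sQ.1].
  move=> a p q [Sp Qp] [Sq Qq]; split; first exact: opS_linear.2.
  by rewrite clsDZ //; apply: sQ.2.
have W0 : @opS0 R d F `<=` W.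
  apply: (lin_span_sub sW) => _ [n n0 <-]; apply: (L_sym_in_subspace sW) => z.
  by split; [exact: opS_iter_creation|exact: iter_creation_differences].
rewrite -closure_resolvent_differences.
apply: closure_subset; apply: (lin_span_sub sQ) => _ [p p0 <-].
by have [] := W0 _ p0.
Qed.

Section Represented.
Variables (b : 'rV[C]_d -> C) (mu_b : represents mu b).
Hypothesis b_neq1 : forall z, unit_ball z -> b z != 1.

(** The operator under the state in the Herglotz representation is
    2 G_z^* - I, whose value is an inner product in P^2. *)
Lemma herglotz z : unit_ball z ->
  (1 + b z) / (1 - b z) = 2 * inner one (cls (resolvent z)) - inner one one
   + 'i * 'Im ((1 + b 0) / (1 - b 0)).
Proof.
move=> Bz; rewrite mu_b //; congr (_ + _).
have SG : opS (resolvent z : F -> F) := opS_resolvent Bz.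
have bG := opS_bounded SG.
have -> : (idfun + zLstar z) \o op_inv (idfun - zLstar z) =
    2 *: adj (resolvent z) + (-1) *: (idfun : F -> F).
  rewrite op_inv_zLstar // -adj_creation; apply/funext => u; apply: eq_inner => v.
  have bA := bounded_creation F z.
  have [_ _ GA _] := resolvent_spec F Bz.
  rewrite /= !fctE /= !innerDl innerZl innerZl -!adjPr // [in LHS](GA v) innerDr.
  have -> : inner u (resolvent z (creation z v)) = inner u (resolvent z v) - inner u v.
    by rewrite [in RHS](GA v) innerDr addrC addKr.
  by ring.
have Si := opS_id; rewrite mu_adjDZ //; last exact: (subspaceZ opS_linear).
by rewrite clsZ // innerZl mulN1r.
Qed.

(** By this formula, sending the class of G_z to k_z / (1 - b(z)^* ) preserves
    inner products. *)
Lemma gram_resolvent z w : unit_ball z -> unit_ball w ->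
  inner (cls (resolvent w)) (cls (resolvent z)) =
  dbr_kernel b z w / ((1 - b z) * (1 - b w)^*).
Proof.
move=> Bz Bw; have hz := herglotz Bz.
have bz : 1 - b z != 0 by rewrite subr_eq0 eq_sym b_neq1.
have bw : 1 - (b w)^* != 0.
  by rewrite -(rmorph1 Num.conj) -rmorphB /= conjC_eq0 subr_eq0 eq_sym b_neq1.
have hw : (1 + (b w)^*) / (1 - (b w)^*) =
    2 * inner (cls (resolvent w)) one - inner one one - 'i * 'Im ((1 + b 0) / (1 - b 0)).
  transitivity (((1 + b w) / (1 - b w))^*); first by rewrite fmorph_div rmorphB rmorphD rmorph1.
  rewrite herglotz // [LHS]rmorphD /=; congr (_ + _).
    by rewrite rmorphB rmorphM /= -!innerC conjC_nat.
  by rewrite rmorphM /= conjCi conj_Creal ?Creal_Im // mulNr.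
apply: (mulfI (zdot_neq1 Bz Bw)); rewrite inner_cls_resolvent //.
have -> : inner one (cls (resolvent z)) + inner (cls (resolvent w)) one - inner one one
  = ((1 + b z) / (1 - b z) + (1 + (b w)^*) / (1 - (b w)^*)) / 2.
  by rewrite hw hz; field.
rewrite /dbr_kernel rmorphB rmorph1; field.
by rewrite bz bw zdot_neq1.
Qed.

End Represented.
End Model.
End State.

(** * Contractive relations and the space H(b) *)

Section Contractive_extension.
Context {R : realType} {H : hilbertType R}.
Local Notation C := R[i].

Lemma norm_fst_le (x : H * H) : `|x.1| <= `|x|.
Proof. by rewrite prod_normE maxEle; case: ifP. Qed.

Lemma norm_snd_le (x : H * H) : `|x.2| <= `|x|.
Proof.
rewrite prod_normE maxEle; case: ifP => // /negbT.
by rewrite -real_ltNge ?normr_real // => /ltW.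
Qed.

(** The closure of the graph is again linear and contractive; it is the graph
    of an everywhere defined function because its domain is dense and the
    space is complete.  Taking [G] as a relation avoids proving beforehand
    that the second coordinate depends only on the first. *)
Lemma contractive_extension (G : set (H * H)) :
  linear_subspace G -> (forall p, G p -> `|p.2| <= `|p.1|) ->
  closure [set p.1 | p in G] = setT ->
  exists2 T : H -> H, bounded_op T & forall p, G p -> T p.1 = p.2.
Proof.
move=> sG G_contr G_dense.
have sG' := subspace_closure sG.
have contr x : closure G x -> `|x.2| <= `|x.1|.
  move=> /closureP xG; apply: le_eps; rewrite ?normr_real // => e e0.
  have [y Gy xy] := xG _ (divr_gt0 e0 (ltr0n _ 2)).
  rewrite -(subrK y.2 x.2) (le_trans (ler_normD _ _)) //.
  have h2 : `|x.2 - y.2| <= e / 2 by apply: le_trans (norm_snd_le (x - y)) (ltW xy).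
  have h1 : `|x.1 - y.1| <= e / 2 by apply: le_trans (norm_fst_le (x - y)) (ltW xy).
  have hy : `|y.1| <= e / 2 + `|x.1|.
    by rewrite -{1}(subrK x.1 y.1) (le_trans (ler_normD _ _)) // lerD2r distrC.
  by rewrite [e]splitr [leRHS]addrC -addrA lerD // (le_trans (G_contr _ Gy)).
have graph h : exists l, closure G (h, l).
  have near n : exists p, G p /\ `|h - p.1| <= n.+1%:R^-1 / 2.
    have : closure [set p.1 | p in G] h by rewrite G_dense.
    have n0 : 0 < n.+1%:R^-1 / 2 :> C by rewrite divr_gt0 // invr_gt0 ltr0n.
    by move=> /closureP/(_ _ n0)[_ [p Gp <-]] hp; exists p; split=> //; apply: ltW.
  have [p pP] := choice near.
  have [|r r0|l lP] := @cauchy_seq_lim R H (fun n => (p n).2) (fun n => n.+1%:R^-1).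
  - move=> n m nm; have [Gn hn] := pP n; have [Gm hm] := pP m.
    have Gd : G (p m - p n) by apply: subspaceB.
    have mn : m.+1%:R^-1 <= n.+1%:R^-1 :> C by rewrite lef_pV2 ?posrE ?ltr0n // ler_nat ltnS.
    apply: (le_trans (G_contr _ Gd)) => /=.
    rewrite -(subrK h (p m).1) -addrA (le_trans (ler_normD _ _)) // [leRHS]splitr.
    by rewrite lerD // distrC (le_trans hm) // ler_wpM2r // invr_ge0.
  - by have [n nr] := small_inv r0; exists n.
  exists l; apply/closureP => e e0; have [n nr] := small_inv e0.
  have [Gn hn] := pP n; exists (p n) => //; apply: le_lt_trans nr.
  rewrite prod_normE maxEle; case: ifP => _ /=; first exact: lP.
  by rewrite (le_trans hn) // ler_piMr ?invr_ge0 ?ler0n // invf_le1 // ler1n.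
have [T TP] := choice graph.
have T_unique h l : closure G (h, l) -> T h = l.
  move=> hl; have := contr _ (subspaceB sG' (TP h) hl).
  by rewrite /= subrr normr0 normr_le0 subr_eq0 => /eqP.
exists T.
  split=> [a u v|]; first by apply: T_unique; apply: (sG'.2 a _ _ (TP u) (TP v)).
  by exists 1 => u; rewrite mul1r; apply: contr (TP u).
by move=> [u v] Gp; apply: T_unique; apply: subset_closure.
Qed.

End Contractive_extension.

Section Formal_combinations.
Context {R : realType} {d : nat}.
Local Notation C := R[i].
Implicit Types (c : seq (C * 'rV[C]_d)).

(** A list of pairs (coefficient, point) stands for a formal combination of
    points; several vectors and scalars are read off from one such list. *)
Definition supported c : Prop := forall p, p \in c -> unit_ball p.2.

Definition weighted_sum {V : lmodType C} (f : 'rV[C]_d -> V) c : V :=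
  \sum_(p <- c) p.1 *: f p.2.

Definition combine a c c' : seq (C * 'rV[C]_d) := [seq (a * p.1, p.2) | p <- c] ++ c'.

Lemma supported_combine a c c' : supported c -> supported c' -> supported (combine a c c').
Proof.
move=> Sc Sc' p; rewrite mem_cat => /orP[/mapP[q qc ->]|]; [exact: (Sc _ qc)|exact: Sc'].
Qed.

Lemma weighted_sum_combine {V : lmodType C} (f : 'rV[C]_d -> V) a c c' :
  weighted_sum f (combine a c c') = a *: weighted_sum f c + weighted_sum f c'.
Proof.
rewrite /weighted_sum big_cat big_map scaler_sumr; congr (_ + _).
by apply: eq_bigr => p _; rewrite scalerA.
Qed.

Lemma inner_weighted_sum {H : hilbertType R} (f g : 'rV[C]_d -> H) c c' :
  inner (weighted_sum f c) (weighted_sum g c') =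
  \sum_(p <- c) \sum_(q <- c') p.1 * q.1^* * inner (f p.2) (g q.2).
Proof.
rewrite inner_suml; apply: eq_bigr => p _; rewrite inner_sumr; apply: eq_bigr => q _.
by rewrite innerZl innerZr mulrA.
Qed.

End Formal_combinations.

Section De_Branges_Rovnyak.
Context {R : realType} {d : nat} {b : 'rV[R[i]]_d -> R[i]}.
Variable Hb : deBranges_rovnyak b.
Local Notation C := R[i].
Local Notation kern := (rk_fun Hb).
Implicit Types (z w : 'rV[C]_d) (f h : Hb) (c : seq (C * 'rV[C]_d)).

Let B0 := @unit_ball0 R d.

Lemma inner_kernel z w : unit_ball z -> unit_ball w ->
  inner (kern w) (kern z) = dbr_kernel b z w.
Proof. by move=> Bz Bw; rewrite -rk_reproducing // rk_funE. Qed.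

(** If b(z) = 1 then k_z has norm 0, hence 1 - b(w) b(z)^* vanishes for all w. *)
Lemma b_neq1 : ~ (exists a, forall z, unit_ball z -> b z = a) ->
  forall z, unit_ball z -> b z != 1.
Proof.
move=> b_nonconstant z Bz; apply/eqP => bz; apply: b_nonconstant; exists 1 => w Bw.
have kz0 : kern z = 0.
  by apply: inner_eq0; rewrite inner_kernel // /dbr_kernel bz rmorph1 mulr1 subrr mul0r.
have := inner_kernel Bw Bz; rewrite kz0 inner0l /dbr_kernel bz rmorph1 mulr1.
move/esym/eqP; rewrite mulf_eq0 invr_eq0 (negPf (zdot_neq1 Bw Bz)) orbF subr_eq0.
by move/eqP.
Qed.

(** A vector orthogonal to all the kernel functions vanishes on the ball. *)
Lemma dense_kernels : closure (lin_span [set kern z | z in unit_ball]) = setT.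
Proof.
set W := closure _; have sW : linear_subspace W by apply/subspace_closure/subspace_lin_span.
apply/seteqP; split=> // x _.
have cW : closure W `<=` W by have /closure_id <- := @closed_closure Hb (lin_span [set kern z | z in unit_ball]).
have [p Wp orth] := projection sW cW x.
suff -> : x = p by [].
apply: rk_eval_inj => z Bz; rewrite !rk_reproducing //; apply/eqP.
rewrite -subr_eq0 -innerBl orth //.
by apply/subset_closure/lin_span_gen; exists z.
Qed.

Local Notation alpha := (weighted_sum (fun=> 1 : C^o)).
Local Notation beta := (weighted_sum (fun z => (b z)^* : C^o)).
Local Notation comb := (weighted_sum kern).
Local Notation coord j := (weighted_sum (fun z => (z ord0 j)^* *: kern z)).

Lemma alphaE c : alpha c = \sum_(p <- c) p.1.
Proof. by apply: eq_bigr => p _; rewrite /GRing.scale /= mulr1. Qed.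

Lemma betaE c : beta c = \sum_(p <- c) p.1 * (b p.2)^*.
Proof. by []. Qed.

Lemma inner_comb_kern0 c : supported c -> inner (comb c) (kern 0) = alpha c - b 0 * beta c.
Proof.
move=> Sc; rewrite inner_suml alphaE betaE mulr_sumr -sumrB.
rewrite !big_seq; apply: eq_bigr => p pc; rewrite innerZl inner_kernel //; last exact: Sc.
by rewrite /dbr_kernel zdot0l subr0 divr1 mulrBr mulr1 mulrCA.
Qed.

(** Multiply the kernel by zw^* : k(z,w) zw^* = k(z,w) - 1 + b(z) b(w)^*. *)
Lemma inner_coord c c' : supported c -> supported c' ->
  \sum_(j < d) inner (coord j c) (coord j c') =
  inner (comb c) (comb c') - alpha c * (alpha c')^* + beta c * (beta c')^*.
Proof.
move=> Sc Sc'; under eq_bigr do rewrite inner_weighted_sum.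
rewrite exchange_big inner_weighted_sum !alphaE !betaE !rmorph_sum /= !mulr_suml.
rewrite -sumrB -big_split /= big_seq [RHS]big_seq; apply: eq_bigr => p pc.
rewrite exchange_big !mulr_sumr -sumrB -big_split /= big_seq [RHS]big_seq; apply: eq_bigr => q qc.
have Bp := Sc _ pc; have Bq := Sc' _ qc.
rewrite -mulr_sumr.
have -> : \sum_(j < d) inner ((p.2 ord0 j)^* *: kern p.2) ((q.2 ord0 j)^* *: kern q.2)
    = zdot q.2 p.2 * inner (kern p.2) (kern q.2).
  rewrite /zdot mulr_suml; apply: eq_bigr => j _.
  by rewrite innerZl innerZr conjCK mulrA [_^* * _]mulrC.
rewrite inner_kernel // /dbr_kernel rmorphM /= conjCK; have := zdot_neq1 Bq Bp.
by move=> n1; field.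
Qed.

Section Gleason.
Variable X : 'I_d -> Hb -> Hb.

(** The Gleason identity paired with kernel functions: [coord j c] carries the
    factors z_j that the identity sums over. *)
Lemma gleason_pairing c h : gleason_solution X -> supported c ->
  \sum_(j < d) inner (X j h) (coord j c) =
  inner h (comb c) - inner h (kern 0) * (alpha c)^*.
Proof.
move=> [_ glX] Sc; rewrite alphaE rmorph_sum mulr_sumr.
under eq_bigr do rewrite inner_sumr.
rewrite exchange_big inner_sumr -sumrB /= !big_seq; apply: eq_bigr => p pc.
have Bp := Sc _ pc.
rewrite innerZr [inner h (kern 0) * _]mulrC -mulrBr -!rk_reproducing // glX // mulr_sumr.
apply: eq_bigr => j _; rewrite !innerZr conjCK rk_reproducing //.
Qed.

Lemma bounded_defect : bounded_op (defect : Hb -> Hb).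
Proof.
rewrite /defect addrC -scaleN1r; apply: bounded_opDZ; last exact: bounded_op_id.
split=> [a u v|]; first by rewrite /rank1 innerDZl scalerDl scalerA.
exists (`|kern 0| * `|kern 0|) => u; rewrite /rank1 normrZ mulrAC ler_wpM2r //.
by rewrite mulrC cauchy_schwarz.
Qed.

Lemma inner_defect h h' : inner (defect h : Hb) h' =
  inner h h' - inner h (kern 0) * inner (kern 0) h'.
Proof. by rewrite /defect /rank1 !fctE /= innerBl innerZl. Qed.

Lemma inner_sum_adj h h' : (forall j, bounded_op (X j)) ->
  inner ((\sum_(j < d) (adj (X j) \o X j)) h) h' = \sum_(j < d) inner (X j h) (X j h').
Proof.
by move=> bX; rewrite fct_sumE inner_suml; apply: eq_bigr => j _; rewrite /= -adjPr.
Qed.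

(** For h = [comb c], both sum_j <X_j h, g_j> and sum_j |g_j|^2, where g_j is
    [coord j c], are equal to |h|^2 - |<h, k_0>|^2, and contractivity bounds
    sum_j |X_j h|^2 by the same number.  So sum_j |X_j h - g_j|^2 <= 0. *)
Lemma contractive_coord c : contractive_solution X -> supported c -> beta c = 0 ->
  forall j, X j (comb c) = coord j c.
Proof.
move=> [glX leX] Sc bc; have bX := glX.1; set h := comb c.
have a0 : inner h (kern 0) = alpha c by rewrite inner_comb_kern0 // bc mulr0 subr0.
have pair := gleason_pairing h glX Sc; rewrite a0 in pair.
have gram := inner_coord Sc Sc; rewrite bc mul0r addr0 in gram.
have := leX h; rewrite !fctE innerBl inner_defect inner_sum_adj // (innerC h (kern 0)) a0 => contr.
have sum0 : \sum_(j < d) `|X j h - coord j c| ^+ 2 = 0.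
  apply/le_anti; rewrite sumr_ge0 ?andbT => [|j _]; last exact: exprn_ge0.
  under eq_bigr do rewrite sqr_normB -!inner_norm.
  rewrite big_split /= gram !sumrB -rmorph_sum /= pair.
  rewrite -oppr_ge0; move: contr; congr (0 <= _).
  rewrite rmorphB rmorphM /= conjCK -innerC /h.
  by ring.
move=> j; apply/eqP; rewrite -subr_eq0 -normr_eq0 -sqrf_eq0.
by have /psumr_eq0P := sum0; move=> ->  // i _; apply: exprn_ge0.
Qed.

End Gleason.

Section Transfer.
Hypothesis b_nonconstant : ~ exists a, forall z, unit_ball z -> b z = a.
Context {F : fock R d} {mu : (F -> F) -> C} (mu_state : is_state mu).
Variables (mu_b : represents mu b) (P : P2 mu).
Local Notation cls := (p2_class P).

Lemma norm_transfer c : supported c ->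
  `|weighted_sum (fun z => cls (resolvent z)) c| =
  `|weighted_sum (fun z => (1 - b z)^*^-1 *: kern z) c|.
Proof.
move=> Sc; apply/eqP; rewrite -(@eqrXn2 _ 2) // -!inner_norm !inner_weighted_sum.
apply/eqP; rewrite big_seq [RHS]big_seq; apply: eq_bigr => p pc.
rewrite big_seq [RHS]big_seq; apply: eq_bigr => q qc; congr (_ * _).
have Bp := Sc _ pc; have Bq := Sc _ qc.
rewrite (gram_resolvent mu_state P mu_b (b_neq1 b_nonconstant)) //.
have cq : ((1 - b q.2)^*^-1)^* = (1 - b q.2)^-1 by rewrite (fmorphV Num.conj) /= conjCK.
by rewrite innerZl innerZr cq inner_kernel // invfM mulrC -mulrA [RHS]mulrCA.
Qed.

Lemma resolvent0 : resolvent 0 = idfun :> (F -> F).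
Proof.
apply/funext => u; rewrite (resolvent_fix B0) creationE big1 ?addr0 //.
by move=> j _; rewrite mxE conjC0 scale0r.
Qed.

(** Quasi-extremity makes the class of the identity, which is that of G_0, a
    limit of combinations of differences [G_z] - [I], whose coefficients sum to
    0.  The error is a short combination of the [G_z] with coefficients of sum
    1; transport it to H(b) by [norm_transfer]. *)
Lemma small_combination (e : C) : @P20 R d F mu P = setT -> 0 < e ->
  exists c, [/\ supported c, alpha c - beta c = 1 & `|comb c| < e].
Proof.
move=> qe e0; pose ws := weighted_sum (fun z => cls (resolvent z)).
pose W := [set v | exists c, [/\ supported c, alpha c = 0 & ws c = v]].
have sW : linear_subspace W.
  split; first by exists [::]; split=> //; rewrite /ws /weighted_sum big_nil.
  move=> a _ _ [c [Sc ac <-]] [c' [Sc' ac' <-]]; exists (combine a c c').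
  split; [exact: supported_combine| |exact: weighted_sum_combine].
  by rewrite weighted_sum_combine ac ac' scaler0 addr0.
have genW : [set cls (resolvent z) - cls idfun | z in @unit_ball R d] `<=` W.
  move=> _ [z Bz <-]; exists [:: (1, z); (-1, 0)]; split.
  - by move=> p; rewrite !inE => /orP[] /eqP ->.
  - by rewrite /weighted_sum !big_cons big_nil addr0 scale1r scaleN1r subrr.
  - by rewrite /ws /weighted_sum !big_cons big_nil addr0 scale1r scaleN1r resolvent0.
have : @P20 R d F mu P (cls idfun) by rewrite qe.
move=> /(P20_sub_differences mu_state)/closureP/(_ e e0)[y Wy ye].
have [c [Sc ac cy]] := lin_span_sub sW genW Wy.
pose c1 := combine (-1) c [:: (1, 0)].
have Sc1 : supported c1.
  by apply: supported_combine => // p; rewrite inE => /eqP ->.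
have ac1 : alpha c1 = 1.
  rewrite weighted_sum_combine ac scaler0 add0r /weighted_sum big_cons big_nil.
  by rewrite addr0 scale1r.
have wc1 : ws c1 = cls idfun - y.
  rewrite /ws weighted_sum_combine -/ws -/(ws c) cy scaleN1r addrC.
  by rewrite /ws /weighted_sum big_cons big_nil addr0 scale1r resolvent0.
exists [seq (p.1 / (1 - b p.2)^*, p.2) | p <- c1]; split.
- by move=> _ /mapP[p pc ->]; apply: Sc1 pc.
- rewrite -[RHS]ac1 alphaE betaE -sumrB /weighted_sum big_map big_seq [RHS]big_seq.
  apply: eq_bigr => p pc; have bp := b_neq1 b_nonconstant (Sc1 _ pc).
  have uE : (1 - b p.2)^* = 1 - (b p.2)^* by rewrite rmorphB /= conjC1.
  rewrite /GRing.scale /= mulr1 -[X in X - _]mulr1 -mulrBr -uE divfK //.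
  by rewrite conjC_eq0 subr_eq0 eq_sym.
- suff -> : comb [seq (p.1 / (1 - b p.2)^*, p.2) | p <- c1] =
      weighted_sum (fun z => (1 - b z)^*^-1 *: kern z) c1.
    by rewrite -norm_transfer // -/(ws c1) wc1.
  by rewrite /weighted_sum big_map; apply: eq_bigr => p _; rewrite /= scalerA.
Qed.

End Transfer.

Hypothesis small_comb : forall e : C, 0 < e ->
  exists c, [/\ supported c, alpha c - beta c = 1 & `|comb c| < e].

(** With alpha - beta = 1, the identity <h, k_0> = alpha - b(0) beta becomes
    <h, k_0> = 1 + (1 - b(0)) beta.  For short h this keeps beta away from 0,
    so h can be divided by beta. *)
Lemma small_beta (e : C) : 0 < e ->
  exists c, [/\ supported c, beta c = 1 & `|comb c| < e].
Proof.
(* The first term of [D] makes |<h, k_0>| <= 1/2, the second one pays for the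
   division by beta. *)
move=> e0; pose D : C := 2 * (`|kern 0| + 1) + 2 * `|1 - b 0| / e.
have D1 : 0 < 2 * (`|kern 0| + 1) by rewrite mulr_gt0 // ltr_wpDl.
have D2 : 0 <= 2 * `|1 - b 0| / e by rewrite divr_ge0 ?mulr_ge0 // ltW.
have D0 : 0 < D by rewrite ltr_wpDr.
have Di : 0 < D^-1 by rewrite invr_gt0.
have [c [Sc ab cD]] := small_comb Di.
have ip : inner (comb c) (kern 0) = 1 + (1 - b 0) * beta c.
  rewrite inner_comb_kern0 //; have -> : alpha c = 1 + beta c by apply/eqP; rewrite -subr_eq ab.
  by rewrite mulrBl mul1r addrA.
have ip_le : `|inner (comb c) (kern 0)| <= 2^-1.
  rewrite (le_trans (cauchy_schwarz _ _)) //.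
  apply: (le_trans (ler_wpM2r (normr_ge0 _) (ltW cD))).
  rewrite mulrC ler_pdivrMr // mulrDr mulrA mulVf ?pnatr_eq0 // mul1r.
  by rewrite -addrA lerDl addr_ge0 // mulr_ge0 // invr_ge0.
have beta_ge : 2^-1 <= `|1 - b 0| * `|beta c|.
  rewrite -normrM; move: ip; set x := (1 - b 0) * _ => ip.
  have := ler_normB (inner (comb c) (kern 0)) x; rewrite {1}ip addrK normr1 => le1.
  rewrite -(lerD2l 2^-1) (_ : 2^-1 + 2^-1 = 1); last by field.
  by rewrite (le_trans le1) // lerD2r.
have bn : 0 < `|1 - b 0| * `|beta c| by apply: lt_le_trans beta_ge; rewrite invr_gt0.
have b0 : beta c != 0 by apply: contraTneq bn => ->; rewrite normr0 mulr0 ltxx.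
have nb : 0 < `|beta c| by rewrite normr_gt0.
(* |beta c| is at least 1 / (2 |1 - b(0)|), and [D] absorbs its inverse. *)
exists (combine (beta c)^-1 c [::]).
have wE (V : lmodType C) (g : 'rV[C]_d -> V) :
    weighted_sum g (combine (beta c)^-1 c [::]) = (beta c)^-1 *: weighted_sum g c.
  by rewrite weighted_sum_combine [X in _ + X]/weighted_sum big_nil addr0.
split; first exact: supported_combine.
  by rewrite wE /GRing.scale /= mulVf.
rewrite wE normrZ normfV mulrC ltr_pdivrMr //.
apply: (lt_le_trans cD); rewrite -[leLHS]mul1r ler_pdivrMr //.
have h : 2 * `|1 - b 0| <= e * D.
  by rewrite mulrDr [e * (_ / e)]mulrC divfK ?gt_eqF // lerDr mulr_ge0 // ltW.
rewrite mulrAC mulrC; apply: (@le_trans _ _ (`|beta c| * (2 * `|1 - b 0|))).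
  rewrite mulrCA [_ * `|1 - _|]mulrC -ler_pdivrMl // mulr1.
  exact: beta_ge.
by rewrite ler_wpM2l.
Qed.

(** These are the vectors on which every contractive solution is prescribed. *)
Definition b_free : set Hb := [set comb c | c in [set c | supported c /\ beta c = 0]].

(** Adding a multiple of a combination given by [small_beta] corrects the
    value of [beta] to 0 and moves the vector arbitrarily little. *)
Lemma b_free_dense : closure b_free = setT.
Proof.
apply/seteqP; split=> // x _; apply/closureP => e e0.
have : closure (lin_span [set kern z | z in @unit_ball R d]) x by rewrite dense_kernels.
move=> /closureP/(_ _ (divr_gt0 e0 (ltr0n C 2)))[y span_y xy].
pose W := [set v | exists2 c, supported c & comb c = v].
have sW : linear_subspace W.
  split; first by exists [::] => //; rewrite /weighted_sum big_nil.
  move=> a _ _ [c Sc <-] [c' Sc' <-]; exists (combine a c c').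
    exact: supported_combine.
  exact: weighted_sum_combine.
have genW : [set kern z | z in @unit_ball R d] `<=` W.
  move=> _ [z Bz <-]; exists [:: (1, z)] => [p|].
    by rewrite inE => /eqP ->.
  by rewrite /weighted_sum big_cons big_nil addr0 scale1r.
have [c0 Sc0 c0y] := lin_span_sub sW genW span_y.
have b1 : 0 < `|beta c0| + 1 by rewrite ltr_wpDl.
have [c1 [Sc1 bc1 nc1]] := small_beta (divr_gt0 (divr_gt0 e0 (ltr0n C 2)) b1).
exists (comb (combine (- beta c0) c1 c0)).
  exists (combine (- beta c0) c1 c0) => //; split; first exact: supported_combine.
  by rewrite weighted_sum_combine bc1 /GRing.scale /= mulr1 addNr.
rewrite weighted_sum_combine c0y scaleNr opprD opprK addrCA.
rewrite (le_lt_trans (ler_normD _ _)) // [e]splitr ler_ltD // normrZ.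
apply: (le_trans (ler_wpM2l (normr_ge0 _) (ltW nc1))).
by rewrite mulrCA ger_pMr ?divr_gt0 // ler_pdivrMr // mul1r lerDl.
Qed.

Lemma b_free_lin_dense : closure (lin_span b_free) = setT.
Proof.
apply/seteqP; split=> // x _; have : closure b_free x by rewrite b_free_dense.
by apply: closure_subset => y; apply: lin_span_gen.
Qed.

Section Solutions.
Variable X : 'I_d -> Hb -> Hb.
Hypothesis bX : forall j, bounded_op (X j).
Hypothesis X_coord : forall c, supported c -> beta c = 0 ->
  forall j, X j (comb c) = coord j c.

(** By [inner_coord], the two sides have the same matrix entries between
    vectors of [b_free]. *)
Lemma sum_adj_eq_defect : \sum_(j < d) (adj (X j) \o X j) = defect.
Proof.
apply/funext => h; apply/subr0_eq.
pose T : Hb -> Hb := (-1) *: defect + \sum_(j < d) (adj (X j) \o X j).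
suff /(_ h) : forall u, T u = 0 by rewrite /T !fctE /= scaleN1r addrC.
apply: (dense_op_eq0 b_free_lin_dense).
  apply: bounded_opDZ; first exact: bounded_defect.
  apply: (subspace_sum subspace_bounded_op) => j _.
  by apply: bounded_op_comp => //; apply: bounded_op_adj.
move=> _ [c [Sc bc] <-]; apply: (dense_orthogonal_eq0 b_free_lin_dense).
move=> _ [c' [Sc' bc'] <-]; rewrite innerC; apply/eqP; rewrite conjC_eq0; apply/eqP.
rewrite /T !fctE /= -/(\sum_(j < d) (adj (X j) \o X j)) innerDl innerZl inner_defect.
rewrite inner_sum_adj //; under eq_bigr do rewrite !X_coord //.
rewrite inner_coord // bc mul0r addr0 [inner (kern 0) _]innerC !inner_comb_kern0 //.
by rewrite bc bc' !mulr0 !subr0; ring.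
Qed.

(** For f in [b_free], the identity at z is [inner_coord] against the single
    point z; both sides are continuous in f. *)
Lemma coord_gleason : gleason_solution X.
Proof.
split=> // f z Bz.
pose v := kern z - kern 0 - \sum_(j < d) (z ord0 j)^* *: adj (X j) (kern z).
suff v0 : v = 0.
  apply/eqP; rewrite -subr_eq0; apply/eqP; transitivity (inner f v); last by rewrite v0 inner0r.
  rewrite /v !innerBr inner_sumr !rk_reproducing //; congr (_ - _).
  by apply: eq_bigr => j _; rewrite innerZr conjCK -adjP // rk_reproducing.
apply: (dense_orthogonal_eq0 b_free_lin_dense) => _ [c [Sc bc] <-].
have Sz : supported [:: (1 : C, z)] by move=> p; rewrite inE => /eqP ->.
have single (V : lmodType C) (g : 'rV[C]_d -> V) : weighted_sum g [:: (1, z)] = g z.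
  by rewrite /weighted_sum big_cons big_nil addr0 scale1r.
have := inner_coord Sc Sz; rewrite bc mul0r addr0 !single conjC1 mulr1 => cz.
rewrite /v !innerBr inner_sumr inner_comb_kern0 // bc mulr0 subr0 -cz.
apply/eqP; rewrite subr_eq0; apply/eqP/eq_bigr => j _.
rewrite [in RHS]innerZr conjCK -adjP // X_coord //.
by rewrite single innerZr conjCK.
Qed.

Lemma coord_contractive : contractive_solution X.
Proof.
split; first exact: coord_gleason.
by rewrite sum_adj_eq_defect /op_le => h; rewrite subrr inner0l.
Qed.

End Solutions.

Lemma coord_solution_exists : exists X : 'I_d -> Hb -> Hb,
  (forall j, bounded_op (X j)) /\
  (forall c, supported c -> beta c = 0 -> forall j, X j (comb c) = coord j c).
Proof.
(* The relation is contractive because |coord j c|^2 <= |comb c|^2 - |alpha c|^2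
   when beta vanishes. *)
have ext j : exists T : Hb -> Hb, bounded_op T /\
    forall c, supported c -> beta c = 0 -> T (comb c) = coord j c.
  pose G := [set p : Hb * Hb | exists c,
    [/\ supported c, beta c = 0 & p = (comb c, coord j c)]].
  have [||| T bT GT] := @contractive_extension R Hb G.
  - split.
      by exists [::]; split=> //; rewrite /weighted_sum !big_nil.
    move=> a _ _ [c [Sc bc ->]] [c' [Sc' bc' ->]]; exists (combine a c c').
    split; first exact: supported_combine.
      by rewrite weighted_sum_combine bc bc' scaler0 addr0.
    by rewrite !weighted_sum_combine.
  - move=> _ [c [Sc bc ->]] /=; rewrite -ler_sqr ?nnegrE //.
    apply: (@le_trans _ _ (\sum_(i < d) `|coord i c| ^+ 2)).
      rewrite (bigD1 j) //= lerDl; apply: sumr_ge0 => i _; exact: exprn_ge0.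
    under eq_bigr do rewrite -inner_norm.
    rewrite inner_coord // bc mul0r addr0 inner_norm.
    by rewrite gerBl mul_conjC_ge0.
  - rewrite -b_free_dense; congr closure; apply/seteqP; split=> [_ [p [c [Sc bc ->]] <-]|].
      by exists c.
    by move=> _ [c [Sc bc] <-]; exists (comb c, coord j c) => //; exists c.
  by exists T; split=> // c Sc bc; apply: (GT (comb c, coord j c)); exists c.
have [X XP] := choice ext.
exists X; split=> [j|c Sc bc j]; first by have [] := XP j.
by have [_] := XP j; apply.
Qed.

Lemma coord_unique (X Y : 'I_d -> Hb -> Hb) :
  (forall j, bounded_op (X j)) -> (forall j, bounded_op (Y j)) ->
  (forall c, supported c -> beta c = 0 -> forall j, X j (comb c) = coord j c) ->
  (forall c, supported c -> beta c = 0 -> forall j, Y j (comb c) = coord j c) ->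
  X = Y.
Proof.
move=> bX bY Xc Yc; apply/funext => j; apply/funext => h; apply/subr0_eq.
suff /(_ h) : forall u, ((-1) *: Y j + X j) u = 0 by rewrite !fctE /= scaleN1r addrC.
apply: (dense_op_eq0 b_free_lin_dense); first exact: bounded_opDZ.
by move=> _ [c [Sc bc] <-]; rewrite !fctE /= Xc // Yc // scaleN1r addNr.
Qed.

End De_Branges_Rovnyak.

Theorem theorem4p8 (R : realType) (d : nat) (hd : (1 <= d)%N)
    (b : 'rV[R[i]]_d -> R[i])
    (H2 : drury_arveson R d) (hb : contractive_multiplier H2 b)
    (b_nonconstant : ~ exists c : R[i], forall z, unit_ball z -> b z = c)
    (F : fock R d) (b_quasi_extreme : quasi_extreme F b)
    (Hb : deBranges_rovnyak b) :
  (exists! X : 'I_d -> Hb -> Hb, contractive_solution X) /\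
  (forall X : 'I_d -> Hb -> Hb, contractive_solution X -> extremal_solution X).
Proof.
have [mu [mu_state mu_b [P qe]]] := b_quasi_extreme.
have small e := @small_combination _ _ _ Hb b_nonconstant _ _ mu_state mu_b _ e qe.
have [X [bX Xc]] := coord_solution_exists small.
split.
  exists X; split; first exact: coord_contractive.
  move=> Y cY; apply: (coord_unique small) => //; first exact: cY.1.1.
  by move=> c; apply: contractive_coord.
move=> Y cY; split=> //; apply: (sum_adj_eq_defect small); first exact: cY.1.1.
by move=> c Sc bc; apply: contractive_coord.
Qed.
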